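(* For each positive integer $i$ let $r_i\in\mathbb{Z}_{>0}$ and $e_i\in\mathbb{Z}_{\geq0}$ be given. Set $E:=\sum_i e_i$ and $R:=\prod_i r_i^{ie_i}$, and assume that $E<\infty$ and that $r_1$ is divisible by $r_i$ for every $i$ such that $e_i>0$. Suppose that (a) in the case $e_1>0$: $\gcd(E-1,r_1)=1$; (b) in the case $e_1=0$: for every $i$ with $e_i>0$, the greatest common divisor of $e_i-1$, $r_i$ and all the $e_j$ with $j\neq i$ is $1$. Then there is an injective group homomorphism $$\mathrm{Out}\left(\mathop{*}_{i\geq1}(\mathbb{Z}^i)^{*e_i}\right)\hookrightarrow\mathrm{Out}\left(F_{(E-1)R-\sum_{i}\frac{e_iR}{r_i^i}+1}*\mathop{*}_{i\geq1}(\mathbb{Z}^i)^{*\frac{e_iR}{r_i^i}}\right).$$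
   Context: $F_n$ is the free group of rank $n$; $G^{*n}$ is the free product of $n$ copies of $G$ (trivial if $n=0$); $*$ denotes free product. $\mathrm{Out}(G)=\mathrm{Aut}(G)/\mathrm{Inn}(G)$. *)

(* Defs.v *)
From HB Require Import structures.
From mathcomp Require Import all_boot all_order all_algebra.
From mathcomp Require Import boolp classical_sets cardinality fsbigop.

Set Implicit Arguments.
Unset Strict Implicit.
Unset Printing Implicit Defensive.

Local Open Scope quotient_scope.
Local Open Scope group_scope.

(* Monoid of words over [A] modulo the congruence generated by [rule]; free
   groups and free products below are instances in which every letter turns
   out to be invertible. *)
Section Presented.
Variables (A : choiceType) (rule : seq A -> seq A -> Prop).

Inductive wcong : seq A -> seq A -> Prop :=
| wcong_rule u v : rule u v -> wcong u v
| wcong_refl u : wcong u u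
| wcong_sym u v : wcong u v -> wcong v u
| wcong_trans v u w : wcong u v -> wcong v w -> wcong u w
| wcong_cat u u' v v' :
    wcong u u' -> wcong v v' -> wcong (u ++ v) (u' ++ v').

Definition wcongb : rel (seq A) := fun u v => `[< wcong u v >].

Lemma wcongb_refl : reflexive wcongb.
Proof. by move=> u; apply/asboolP/wcong_refl. Qed.

Lemma wcongb_sym : symmetric wcongb.
Proof. by move=> u v; apply/asbool_equiv_eq; split; apply: wcong_sym. Qed.

Lemma wcongb_trans : transitive wcongb.
Proof.
move=> v u w /asboolP uv /asboolP vw; apply/asboolP; exact: wcong_trans uv vw.
Qed.

Canonical wcong_equiv := EquivRel wcongb wcongb_refl wcongb_sym wcongb_trans.

Definition presented := {eq_quot wcong_equiv}.
HB.instance Definition _ := Choice.on presented.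
HB.instance Definition _ := Quotient.on presented.

Lemma pi_wcong (u v : seq A) :
  wcong u v <-> \pi_presented u = \pi_presented v.
Proof.
split=> [uv|]; first by apply/eqmodP/asboolP.
by move/eqmodP/asboolP.
Qed.

Definition pmul (x y : presented) : presented := \pi_presented (repr x ++ repr y).
Definition pone : presented := \pi_presented [::].

Lemma pi_pmul (u v : seq A) : pmul (\pi u) (\pi v) = \pi_presented (u ++ v).
Proof. by apply/pi_wcong/wcong_cat; apply/pi_wcong; rewrite reprK. Qed.

Lemma pmulA : associative pmul.
Proof.
move=> x y z; rewrite -[x]reprK -[y]reprK -[z]reprK.
by rewrite !pi_pmul catA.
Qed.

Lemma pmul1g : left_id pone pmul.
Proof. by move=> x; rewrite -[x]reprK /pone pi_pmul. Qed.

Lemma pmulg1 : right_id pone pmul.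
Proof. by move=> x; rewrite -[x]reprK /pone pi_pmul cats0. Qed.

HB.instance Definition _ := isMonoid.Build presented pmulA pmul1g pmulg1.

Lemma pi_mulg (u v : seq A) :
  \pi_presented u * \pi_presented v = \pi_presented (u ++ v).
Proof. exact: pi_pmul. Qed.

Lemma pi_nil : \pi_presented [::] = 1.
Proof. by []. Qed.

Variable linv : A -> A.
Hypothesis linv_l : forall a, wcong [:: linv a; a] [::].
Hypothesis linv_r : forall a, wcong [:: a; linv a] [::].

Definition winv (u : seq A) := rev (map linv u).
Definition pinv (x : presented) : presented := \pi_presented (winv (repr x)).

Lemma wcong_winvl u : wcong (winv u ++ u) [::].
Proof.
elim: u => [|a u IH]; first exact: wcong_refl.
have -> : winv (a :: u) ++ a :: u = winv u ++ [:: linv a; a] ++ u.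
  by rewrite /winv /= rev_cons cat_rcons.
apply: wcong_trans IH; apply: wcong_cat (wcong_refl _) _.
exact: (wcong_cat (linv_l a) (wcong_refl u)).
Qed.

Lemma wcong_winvr u : wcong (u ++ winv u) [::].
Proof.
elim: u => [|a u IH]; first exact: wcong_refl.
have -> : (a :: u) ++ winv (a :: u) = [:: a] ++ (u ++ winv u) ++ [:: linv a].
  by rewrite /winv /= rev_cons -cats1 catA.
apply: wcong_trans (linv_r a).
exact: (wcong_cat (wcong_refl [:: a]) (wcong_cat IH (wcong_refl _))).
Qed.

Lemma pmulVg : left_inverse pone pinv pmul.
Proof.
move=> x; rewrite -{2}[x]reprK /pinv pi_pmul.
exact/pi_wcong/wcong_winvl.
Qed.

Lemma pmulgV : right_inverse pone pinv pmul.
Proof.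
move=> x; rewrite -{1}[x]reprK /pinv pi_pmul.
exact/pi_wcong/wcong_winvr.
Qed.

End Presented.

(* The letter [(x, true)] is the generator [x] and [(x, false)] its formal
   inverse. *)
Section FreeGroup.
Variable X : choiceType.

Inductive free_rule : seq (X * bool) -> seq (X * bool) -> Prop :=
| free_cancel x b : free_rule [:: (x, b); (x, ~~ b)] [::].

Definition free_linv (a : X * bool) := (a.1, ~~ a.2).

Lemma free_linv_l a : wcong free_rule [:: free_linv a; a] [::].
Proof.
by case: a => x b; rewrite -{2}[b]negbK; apply: wcong_rule; constructor.
Qed.

Lemma free_linv_r a : wcong free_rule [:: a; free_linv a] [::].
Proof. by case: a => x b; apply: wcong_rule; constructor. Qed.

Definition free_group := presented free_rule.
HB.instance Definition _ := Monoid.on free_group.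
HB.instance Definition _ := Quotient.on free_group.
HB.instance Definition _ := hasInv.Build free_group (pinv free_linv).
HB.instance Definition _ := Monoid_isGroup.Build free_group
  (pmulVg free_linv_l) (pmulgV free_linv_r).

End FreeGroup.

Definition F_ (n : nat) : groupType := free_group 'I_n.

(* Words in the disjoint union of the [G i], modulo [g h = gh] for [g, h] in
   the same factor, and [1 = empty word] for the unit of each factor. *)
Section FreeProduct.
Variables (I : choiceType) (G : I -> groupType).

Definition letter : Type := {i : I & G i}.
HB.instance Definition _ := Choice.on letter.

Definition lett (i : I) (g : G i) : letter := Tagged G g.

Inductive fprod_rule : seq letter -> seq letter -> Prop :=
| fprod_unit i : fprod_rule [:: lett (1 : G i)] [::]
| fprod_mul i (g h : G i) : fprod_rule [:: lett g; lett h] [:: lett (g * h)].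

Definition fprod_linv (a : letter) : letter := lett (tagged a)^-1.

Lemma fprod_linv_l a : wcong fprod_rule [:: fprod_linv a; a] [::].
Proof.
case: a => i g; apply: (wcong_trans (wcong_rule (fprod_mul _ _))).
by rewrite mulVg; apply: wcong_rule; constructor.
Qed.

Lemma fprod_linv_r a : wcong fprod_rule [:: a; fprod_linv a] [::].
Proof.
case: a => i g; apply: (wcong_trans (wcong_rule (fprod_mul _ _))).
by rewrite mulgV; apply: wcong_rule; constructor.
Qed.

Definition free_product := presented fprod_rule.
HB.instance Definition _ := Monoid.on free_product.
HB.instance Definition _ := Quotient.on free_product.
HB.instance Definition _ := hasInv.Build free_product (pinv fprod_linv).
HB.instance Definition _ := Monoid_isGroup.Build free_product
  (pmulVg fprod_linv_l) (pmulgV fprod_linv_r).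

End FreeProduct.

Definition free_product2 (G H : groupType) : groupType :=
  free_product (fun b : bool => if b then G else H).

Definition free_power (G : groupType) (n : nat) : groupType :=
  free_product (fun _ : 'I_n => G).

(* [Z^i], written multiplicatively. *)
Section Zpow.
Variable i : nat.

Definition Zpow : Type := 'rV[int]_i.
HB.instance Definition _ := Choice.on Zpow.
HB.instance Definition _ := @isGroup.Build Zpow 0%R -%R%R +%R%R
  (@GRing.addrA 'rV[int]_i) (@GRing.add0r 'rV[int]_i) (@GRing.addr0 'rV[int]_i)
  (@GRing.addNr 'rV[int]_i) (@GRing.subrr 'rV[int]_i).

End Zpow.

Definition pos_index : choiceType := {i : nat | (0 < i)%N}.

Definition Zfree_product (c : nat -> nat) : groupType :=
  free_product (fun i : pos_index => free_power (Zpow (val i)) (c (val i))).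

Section Automorphisms.
Variable G : groupType.

Record autom : Type := Autom {
  autom_fun :> G -> G;
  autom_inv : G -> G;
  automM : {morph autom_fun : x y / x * y};
  automK : cancel autom_fun autom_inv;
  autom_invK : cancel autom_inv autom_fun }.

Lemma automP (f g : autom) : f =1 g -> f = g.
Proof.
case: f g => [f f' fM fK f'K] [g g' gM gK g'K] /= /funext fg; subst g.
have ? : f' = g' by apply/funext => x; rewrite -{1}[x]g'K fK.
by subst g'; congr Autom; apply: Prop_irrelevance.
Qed.

HB.instance Definition _ := gen_eqMixin autom.
HB.instance Definition _ := gen_choiceMixin autom.

Definition autom1 : autom :=
  @Autom idfun idfun (fun _ _ => erefl) (fun _ => erefl) (fun _ => erefl).

Lemma autom_mulM (f g : autom) : {morph f \o g : x y / x * y}.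
Proof. by move=> x y /=; rewrite !automM. Qed.

Definition autom_mul (f g : autom) : autom :=
  Autom (autom_mulM f g) (can_comp (@automK f) (@automK g))
    (can_comp (@autom_invK g) (@autom_invK f)).

Lemma autom_invM (f : autom) : {morph autom_inv f : x y / x * y}.
Proof. by move=> x y; apply: (can_inj (@automK f)); rewrite automM !autom_invK. Qed.

Definition autom_inverse (f : autom) : autom :=
  Autom (@autom_invM f) (@autom_invK f) (@automK f).

Lemma autom_mulA : associative autom_mul.
Proof. by move=> f g h; apply: automP. Qed.
Lemma autom_mul1g : left_id autom1 autom_mul.
Proof. by move=> f; apply: automP. Qed.
Lemma autom_mulg1 : right_id autom1 autom_mul.
Proof. by move=> f; apply: automP. Qed.
Lemma autom_mulVg : left_inverse autom1 autom_inverse autom_mul.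
Proof. by move=> f; apply: automP => x /=; rewrite automK. Qed.
Lemma autom_mulgV : right_inverse autom1 autom_inverse autom_mul.
Proof. by move=> f; apply: automP => x /=; rewrite autom_invK. Qed.

HB.instance Definition _ := isGroup.Build autom
  autom_mulA autom_mul1g autom_mulg1 autom_mulVg autom_mulgV.

Definition inner (f : autom) : Prop := exists h : G, forall x, f x = x ^ h.

Lemma inner1 : inner 1.
Proof. by exists 1 => x; rewrite conjg1. Qed.

Lemma innerM f g : inner f -> inner g -> inner (f * g).
Proof.
move=> [a fa] [b gb]; exists (b * a) => x.
by rewrite -[(f * g) x]/(f (g x)) gb fa conjgM.
Qed.

Lemma innerV f : inner f -> inner f^-1.
Proof.
move=> [a fa]; exists a^-1 => x.
by apply: (can_inj (@automK f)); rewrite [RHS]fa conjgKV; apply: autom_invK.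
Qed.

Lemma innerJ f g : inner f -> inner (g * f * g^-1).
Proof.
move=> [a fa]; exists (g a) => x.
rewrite -[LHS]/(g (f (autom_inv g x))) fa.
have gX y b : g (y ^ b) = g y ^ g b.
  have gV : g b^-1 = (g b)^-1.
    have g1 : g 1 = 1 by apply: (mulgI (g 1)); rewrite -automM !mulg1.
    by apply: (mulgI (g b)); rewrite -automM !mulgV.
  by rewrite /conjg !automM gV.
by rewrite gX autom_invK.
Qed.

Definition outb : rel autom := fun f g => `[< inner (f * g^-1) >].

Lemma outb_refl : reflexive outb.
Proof. by move=> f; apply/asboolP; rewrite mulgV; apply: inner1. Qed.

Lemma outb_sym : symmetric outb.
Proof.
by move=> f g; apply/asbool_equiv_eq; split=> /innerV; rewrite invgM invgK.
Qed.

Lemma outb_trans : transitive outb.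
Proof.
move=> g f h /asboolP fg /asboolP gh; apply/asboolP.
by have := innerM fg gh; rewrite mulgA mulgVK.
Qed.

Canonical out_equiv := EquivRel outb outb_refl outb_sym outb_trans.

Definition Out := {eq_quot out_equiv}.
HB.instance Definition _ := Choice.on Out.
HB.instance Definition _ := Quotient.on Out.

Lemma pi_outP (f g : autom) : inner (f * g^-1) <-> \pi_Out f = \pi_Out g.
Proof.
split=> [fg|]; first by apply/eqmodP/asboolP.
by move/eqmodP/asboolP.
Qed.

Definition out_mul (x y : Out) : Out := \pi_Out (repr x * repr y).
Definition out_one : Out := \pi_Out (1 : autom).
Definition out_inv (x : Out) : Out := \pi_Out (repr x)^-1.

Lemma pi_out_mul (f g : autom) : out_mul (\pi f) (\pi g) = \pi_Out (f * g).
Proof.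
apply/pi_outP.
have /pi_outP f'f : \pi_Out (repr (\pi_Out f)) = \pi_Out f by rewrite reprK.
have /pi_outP g'g : \pi_Out (repr (\pi_Out g)) = \pi_Out g by rewrite reprK.
set f' := repr _ in f'f *; set g' := repr _ in g'g *.
have := innerM (innerJ f' g'g) f'f.
by rewrite invgM !mulgA mulgVK.
Qed.

Lemma out_mulA : associative out_mul.
Proof.
move=> x y z; rewrite -[x]reprK -[y]reprK -[z]reprK.
by rewrite !pi_out_mul mulgA.
Qed.

Lemma out_mul1g : left_id out_one out_mul.
Proof. by move=> x; rewrite -[x]reprK /out_one pi_out_mul mul1g. Qed.

Lemma out_mulg1 : right_id out_one out_mul.
Proof. by move=> x; rewrite -[x]reprK /out_one pi_out_mul mulg1. Qed.

Lemma out_mulVg : left_inverse out_one out_inv out_mul.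
Proof.
by move=> x; rewrite -{2}[x]reprK /out_inv pi_out_mul mulVg.
Qed.

Lemma out_mulgV : right_inverse out_one out_inv out_mul.
Proof.
by move=> x; rewrite -{1}[x]reprK /out_inv pi_out_mul mulgV.
Qed.

HB.instance Definition _ := isGroup.Build Out
  out_mulA out_mul1g out_mulg1 out_mulVg out_mulgV.

Lemma pi_outM (f g : autom) : \pi_Out f * \pi_Out g = \pi_Out (f * g).
Proof. exact: pi_out_mul. Qed.

End Automorphisms.

(* Main.v *)
Require Import Defs.
From HB Require Import structures.
From mathcomp Require Import all_boot all_order all_algebra.
From mathcomp Require Import boolp classical_sets cardinality fsbigop.
From mathcomp Require Import zify ring.

(** Let [G] be the free product of the given groups [Z^i], one for each of [E]
    factors, and let [K] be the kernel of the map to the product of the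
    [(Z/r_i)^i]. It is invariant under automorphisms: the factors of rank at least
    two are permuted up to conjugation, so their rank is kept, and the modulus
    [r_1] of the cyclic factors is a multiple of the other moduli. Restriction
    to [K] maps [Aut G] to [Aut K], but the inner automorphisms of [G] by elements
    outside [K] do not become inner. What is needed is a subgroup [D] of [Aut G]
    that meets every class of [Out G] and contains the inner automorphism by [g]
    only for [g] in [K]. Then [Out G] maps to [Out K] through [D], and injectively
    because nothing outside [1] centralises [K] when [E] is at least two, while
    the hypotheses force [K = G] otherwise ([out_embedding]).

    The subgroup [D] is the set of zeros of a crossed homomorphism from [Aut G] to
    [G/K] ([crossedM]) whose value on the inner automorphism by [g] is the class of
    [g] times an invertible factor ([crossed_conj]). It is a logarithm of the
    determinant of a Fox Jacobian, computed modulo the square of the augmentation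
    ideal of the group ring of the abelianisation: the linear term of such a
    determinant is the trace of the linear term of the matrix against the inverse
    of its constant term. The Jacobian has one row for each factor. For a cyclic
    factor generated by [x] the row is the Fox derivative of the image of [x]; a
    factor [A] of rank at least two, carried to [w B w^-1], has as row the Fox
    derivative of [w] plus [w] times the basis vector of [B]. On the inner
    automorphism by [g] the trace is [E - 1] times [g]. Without cyclic factors the
    constant term is a permutation matrix that preserves ranks, and the rows can be
    weighted according to their rank; the hypotheses say that suitable weights
    make the multiplier invertible ([weights_exist]).

    That factors of rank at least two are permuted rests on the normal form in
    free products: a conjugate of a factor meets another one trivially
    ([malnormal]), and of two commuting elements, either the first is conjugate into a
    factor or a power of the second is a power of the first ([commute_cases]).

    Finally [K] is identified with the free product in the target. This is
    Kurosh's theorem for the covering graph, whose vertices are the elements of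
    [G/K] together with the cosets of the images of the factors. Ordering the
    factors gives an explicit maximal tree, the path to an element introducing its
    blocks of coordinates one after another. A cocycle on [G] that records the
    edges outside the tree and the elements of the factors of [K] met along the way
    is inverse to the obvious map into [G] ([path_class_Psi], [Psi_path_class]).
    The number of edges outside the tree is the rank of the free part
    ([card_loops]). *)

Set Implicit Arguments.
Unset Strict Implicit.
Unset Printing Implicit Defensive.
Import GRing.Theory Num.Theory.

Local Open Scope quotient_scope.
Local Open Scope group_scope.

(** * Morphisms out of a group given by generators *)

Section Morph.
Variables (G X : groupType) (f : G -> X).
Hypothesis fM : {morph f : x y / x * y}.

Lemma morph_one : f 1 = 1.
Proof. by apply: (mulgI (f 1)); rewrite -fM !mulg1. Qed.

Lemma morph_inv x : f x^-1 = (f x)^-1.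
Proof. by apply: (mulgI (f x)); rewrite -fM !mulgV morph_one. Qed.
End Morph.

Section PresentedLift.
Variables (A : choiceType) (rule : seq A -> seq A -> Prop).

Lemma presented_lift (X : groupType) (h : A -> X) :
  (forall u v, rule u v -> \prod_(a <- u) h a = \prod_(a <- v) h a) ->
  exists2 f : presented rule -> X,
    {morph f : x y / x * y} & forall a, f (\pi [:: a]) = h a.
Proof.
move=> hrule; pose ev u := \prod_(a <- u) h a.
have ev_wcong u v : wcong rule u v -> ev u = ev v.
  elim=> {u v} [u v /hrule //|//|u v _ -> //|u v w _ -> _ -> //|].
  by move=> u u' v v' _ IHu _ IHv; rewrite /ev !big_cat -/(ev u) IHu -/(ev v) IHv.
have ev_pi u : ev (repr (\pi_(presented rule) u)) = ev u.
  by apply/ev_wcong/pi_wcong; rewrite reprK.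
exists (fun x => ev (repr x)) => [x y|a]; last by rewrite ev_pi /ev big_seq1.
by rewrite -{1}[x]reprK -{1}[y]reprK pi_mulg ev_pi /ev big_cat.
Qed.

Lemma presented_ind (P : presented rule -> Prop) :
  P 1 -> (forall a x, P x -> P (\pi_(presented rule) [:: a] * x)) -> forall x, P x.
Proof.
move=> P1 PM x; rewrite -[x]reprK; elim: (repr x) => [|a u IH]; first exact: P1.
have -> : \pi_(presented rule) (a :: u) =
    \pi_(presented rule) [:: a] * \pi_(presented rule) u by rewrite pi_mulg.
exact: PM.
Qed.
End PresentedLift.

Section FreeProductLift.
Variables (I : choiceType) (G : I -> groupType).

Definition fpinj (i : I) (g : G i) : free_product G :=
  \pi_(presented (@fprod_rule I G)) [:: lett g].

Lemma fpinjM i : {morph fpinj (i := i) : x y / x * y}.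
Proof.
by move=> x y; rewrite /fpinj pi_mulg; apply/esym/pi_wcong/wcong_rule; constructor.
Qed.

Lemma free_product_lift (X : groupType) (h : forall i, G i -> X) :
  (forall i, {morph h i : x y / x * y}) ->
  exists2 f : free_product G -> X,
    {morph f : x y / x * y} & forall i g, f (@fpinj i g) = h i g.
Proof.
move=> hM.
have [|f fM fh] := @presented_lift _ (@fprod_rule I G) X (fun a => h (tag a) (tagged a)).
  by move=> u v [i|i g g']; rewrite !big_cons big_nil ?mulg1 /= ?hM // (morph_one (hM i)).
by exists f => // i g; rewrite /fpinj fh.
Qed.

Lemma free_product_ind (P : free_product G -> Prop) :
  P 1 -> (forall i g x, P x -> P (@fpinj i g * x)) -> forall x, P x.
Proof.
move=> P1 PM; apply: (@presented_ind _ (@fprod_rule I G)) => // -[i g] x.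
exact: PM.
Qed.
End FreeProductLift.

Section FreeGroupLift.
Variable X : choiceType.

Definition fgen (x : X) : free_group X := \pi_(presented (@free_rule X)) [:: (x, true)].

Lemma fgenV x : (fgen x)^-1 = \pi_(presented (@free_rule X)) [:: (x, false)].
Proof.
apply: mulg1_eq; rewrite /fgen pi_mulg -pi_nil.
by apply/pi_wcong/wcong_rule; constructor.
Qed.

Lemma free_group_lift (Y : groupType) (h : X -> Y) :
  exists2 f : free_group X -> Y,
    {morph f : x y / x * y} & forall x, f (fgen x) = h x.
Proof.
pose h' (a : X * bool) := if a.2 then h a.1 else (h a.1)^-1.
have [|f fM fh] := @presented_lift _ (@free_rule X) Y h'.
  move=> u v [x b]; rewrite !big_cons !big_nil mulg1 /h' /=.
  by case: b; rewrite ?mulgV ?mulVg.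
by exists f => // x; rewrite /fgen fh.
Qed.

Lemma free_group_ind (P : free_group X -> Prop) :
  P 1 -> (forall x y, P y -> P (fgen x * y) /\ P ((fgen x)^-1 * y)) -> forall x, P x.
Proof.
move=> P1 PM; apply: (@presented_ind _ (@free_rule X)) => // -[x b] y /(PM x) [].
by rewrite fgenV; case: b.
Qed.
End FreeGroupLift.

(** * Free products of free abelian groups and a free group *)

(** Being the free product of the groups [Z^(d j)] and of the free group on
    [Y] is recorded through the universal property and the induction principle
    that it amounts to; this form is insensitive to the bracketing of iterated
    free products and to the choice of the index types. *)
Record is_fp (T : groupType) (J Y : Type) (d : J -> nat)
    (i : forall j, 'rV[int]_(d j) -> T) (y : Y -> T) : Prop := IsFp {
  fp_morph : forall j, {morph i j : u v / (u + v)%R >-> u * v};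
  fp_lift : forall (X : groupType) (h : forall j, 'rV[int]_(d j) -> X) (z : Y -> X),
    (forall j, {morph h j : u v / (u + v)%R >-> u * v}) ->
    exists f : T -> X, [/\ {morph f : x y / x * y},
      forall j v, f (i j v) = h j v & forall k, f (y k) = z k];
  fp_ind : forall P : T -> Prop, P 1 ->
    (forall j v x, P x -> P (i j v * x)) ->
    (forall k x, P x -> P (y k * x) /\ P ((y k)^-1 * x)) -> forall x, P x }.

Section Zfree.
Variable c : nat -> nat.

Let J := {i : pos_index & 'I_(c (val i))}.

Definition Zinj (j : J) (v : 'rV[int]_(val (tag j))) : Zfree_product c :=
  @fpinj pos_index (fun i => free_power (Zpow (val i)) (c (val i))) (tag j)
    (@fpinj 'I_(c (val (tag j))) (fun=> Zpow (val (tag j))) (tagged j) v).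

Lemma Zfree_product_fp :
  @is_fp (Zfree_product c) J void (fun j => val (tag j)) Zinj (of_void _).
Proof.
split=> [j u v|X h z hM|P P1 PM _].
- by rewrite /Zinj -!fpinjM.
- have hi (i : pos_index) : exists f : free_power (Zpow (val i)) (c (val i)) -> X,
      {morph f : x y / x * y} /\
      forall (k : 'I_(c (val i))) v, f (@fpinj 'I_(c (val i)) (fun=> Zpow (val i)) k v) =
        h (existT _ i k) v.
    have [|f fM fh] := @free_product_lift 'I_(c (val i)) (fun=> Zpow (val i)) X
       (fun k v => h (existT (fun i : pos_index => 'I_(c (val i))) i k) v).
      by move=> k u v; apply: hM.
    by exists f.
  pose F i := sval (cid (hi i)); have FP i := svalP (cid (hi i)).
  have [|f fM fh] := @free_product_lift pos_index _ X F.
    by move=> i; have [] := FP i.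
  exists f; split=> // -[i k] v.
  by rewrite /Zinj fh; apply: (FP i).2.
- apply: free_product_ind => // i g x Px.
  elim/(@free_product_ind 'I_(c (val i)) (fun=> Zpow (val i))): g => [|k v y Py].
    by rewrite (morph_one (@fpinjM _ _ i)) mul1g.
  rewrite fpinjM -mulgA.
  exact: (PM (existT _ i k)).
Qed.
End Zfree.

Section FreeZfree.
Variables (n : nat) (c : nat -> nat).

Let J := {i : pos_index & 'I_(c (val i))}.
Let bG (b : bool) : groupType := if b then F_ n else Zfree_product c.

Lemma free_Zfree_product_fp :
  @is_fp (free_product2 (F_ n) (Zfree_product c)) J 'I_n (fun j => val (tag j))
    (fun j v => @fpinj bool bG false (Zinj v)) (fun k => @fpinj bool bG true (fgen k)).
Proof.
have ZP := Zfree_product_fp c.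
split=> [j u v|X h z hM|P P1 PM Py].
- by rewrite (fp_morph ZP); apply: (@fpinjM bool bG false).
- have [h0 [h0M h0h _]] := fp_lift ZP (of_void X) hM.
  have [h1 h1M h1z] := free_group_lift z.
  have [|f fM fh] := @free_product_lift bool bG X
      (fun b => if b as b' return bG b' -> X then h1 else h0).
    by case.
  by exists f; split=> // [j v|k]; rewrite fh.
- apply: free_product_ind => // -[] g x Px.
    move: g; apply: (@free_group_ind _ (fun g => P (@fpinj bool bG true g * x))) => [|k y IH].
      by rewrite (morph_one (@fpinjM bool bG true)) mul1g.
    by rewrite !(@fpinjM bool bG true) (morph_inv (@fpinjM bool bG true)) -!mulgA; apply: Py.
  move: g; apply: (fp_ind ZP (P := fun g => P (@fpinj bool bG false g * x))) => [|j v y IH|[]].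
    by rewrite (morph_one (@fpinjM bool bG false)) mul1g.
  by rewrite (@fpinjM bool bG false) -mulgA; apply: PM.
Qed.
End FreeZfree.

Lemma is_fp_reindex (T : groupType) (J J' Y Y' : Type) (d : J -> nat) (d' : J' -> nat)
    (i : forall j, 'rV[int]_(d j) -> T) (y : Y -> T) (b : J' -> J) (g : Y' -> Y) :
  is_fp i y -> bijective b -> bijective g -> (forall j, d (b j) = d' j) ->
  exists i' : forall j, 'rV[int]_(d' j) -> T, is_fp i' (y \o g).
Proof.
move=> iP [b' bK b'K] [g' gK g'K] db.
have /funext dE : (d \o b) =1 d' by [].
case: d' / dE {db}; exists (fun j => i (b j)); split=> [j|X h z hM|P P1 PM Py].
- exact: (fp_morph iP).
- pose tr k l (e : k = l) (v : 'rV[int]_(d k)) : 'rV[int]_(d l) := ecast m 'rV[int]_(d m) e v.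
  have trD k l (e : k = l) : {morph tr k l e : u v / (u + v)%R} by case: l / e.
  pose h' j v := h (b' j) (tr _ _ (esym (b'K j)) v).
  have h'M j : {morph h' j : u v / (u + v)%R >-> u * v}.
    by move=> u v; rewrite /h' trD hM.
  have [f [fM fh fz]] := fp_lift iP (z \o g') h'M.
  exists f; split=> // [j v|k]; last by rewrite fz /= gK.
  rewrite fh /h'; move: (esym _); rewrite bK => e.
  by rewrite (Prop_irrelevance e erefl).
- apply: (fp_ind iP) => // [j v x|k x]; last by rewrite -[k]g'K; apply: Py.
  by move: v; rewrite -[j]b'K => v; apply: PM.
Qed.

(** * Actions of a free product *)

(** Permutations are composed from left to right, so that a morphism into
    [perms X] is a right action on [X]. *)
Record perms (X : Type) := Perms {
  perm_fun :> X -> X;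
  perm_inv : X -> X;
  permsK : cancel perm_fun perm_inv;
  perms_invK : cancel perm_inv perm_fun }.

Section PermsGroup.
Variable X : Type.

HB.instance Definition _ := gen_eqMixin (perms X).
HB.instance Definition _ := gen_choiceMixin (perms X).

Lemma permsP (f g : perms X) : f =1 g -> f = g.
Proof.
case: f g => [f f' fK f'K] [g g' gK g'K] /= /funext fg; subst g.
have ? : f' = g' by apply/funext => x; rewrite -{1}[x]g'K fK.
by subst g'; congr Perms; apply: Prop_irrelevance.
Qed.

Definition perms1 : perms X := @Perms X id id (fun=> erefl) (fun=> erefl).
Definition permsM (f g : perms X) : perms X :=
  Perms (can_comp (@permsK _ g) (@permsK _ f))
        (can_comp (@perms_invK _ f) (@perms_invK _ g)).
Definition permsV (f : perms X) : perms X := Perms (@perms_invK _ f) (@permsK _ f).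

Lemma permsMA : associative permsM. Proof. by move=> f g h; apply: permsP. Qed.
Lemma perms1M : left_id perms1 permsM. Proof. by move=> f; apply: permsP. Qed.
Lemma permsM1 : right_id perms1 permsM. Proof. by move=> f; apply: permsP. Qed.
Lemma permsVM : left_inverse perms1 permsV permsM.
Proof. by move=> f; apply: permsP => x /=; rewrite perms_invK. Qed.
Lemma permsMV : right_inverse perms1 permsV permsM.
Proof. by move=> f; apply: permsP => x /=; rewrite permsK. Qed.

HB.instance Definition _ := isGroup.Build (perms X) permsMA perms1M permsM1 permsVM permsMV.
End PermsGroup.

Lemma fp_inj0 (T : groupType) (J Y : Type) (d : J -> nat)
    (i : forall j, 'rV[int]_(d j) -> T) (y : Y -> T) :
  is_fp i y -> forall j, i j (0 : 'rV[int]_(d j))%R = 1.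
Proof.
by move=> iP j; apply: (mulgI (i j 0%R)); rewrite -(fp_morph iP) addr0 mulg1.
Qed.

Section FreeProductOfFactors.
Variables (G : groupType) (I : eqType) (d : I -> nat).
Variable i : forall t, 'rV[int]_(d t) -> G.
Hypothesis iP : is_fp i (of_void G).

Lemma fp_injN t (v : 'rV[int]_(d t)) : i (- v)%R = (i v)^-1.
Proof. by apply: (mulgI (i v)); rewrite -(fp_morph iP) subrr mulgV (fp_inj0 iP). Qed.

Lemma fp_injMn t (v : 'rV[int]_(d t)) n : i (v *+ n)%R = i v ^+ n.
Proof.
by elim: n => [|n IH]; rewrite ?mulr0n ?(fp_inj0 iP) // mulrS (fp_morph iP) IH expgS.
Qed.

Lemma fp_act (X : Type) (a : forall t, 'rV[int]_(d t) -> X -> X) :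
  (forall t x, a t 0%R x = x) -> (forall t u v x, a t (u + v)%R x = a t v (a t u x)) ->
  exists A : G -> X -> X, [/\ forall x, A 1 x = x, forall g h x, A (g * h) x = A h (A g x)
    & forall t v x, A (i v) x = a t v x].
Proof.
move=> a0 aD.
have aK t v : cancel (a t v) (a t (- v)%R) by move=> x; rewrite -aD subrr a0.
have aVK t v : cancel (a t (- v)%R) (a t v) by move=> x; rewrite -aD addNr a0.
pose h t v : perms X := Perms (aK t v) (aVK t v).
have [|f [fM fh _]] := fp_lift iP (h := h) (of_void (perms X)).
  by move=> t u v; apply: permsP => x; apply: aD.
exists (fun g => (f g : perms X)); split=> [x|g h' x|t v x]; last by rewrite fh.
- by rewrite (morph_one fM).
- by rewrite fM.
Qed.

(** * Normal form *)

Definition syllable := {t : I & 'rV[int]_(d t)}.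
Implicit Types (t : I) (a b : syllable) (w l : seq syllable).

Definition syl t (v : 'rV[int]_(d t)) : syllable := Tagged (fun t => 'rV[int]_(d t)) v.

(** Words are read from right to left, the head of the list being the last
    syllable of the product. *)
Definition weval w : G := foldr (fun a g => g * i (tagged a)) 1 w.

Definition reduced w :=
  all (fun a => tagged a != 0%R) w && sorted (fun s t => s != t) (map (@tag _ _) w).

Definition free_head t w := if w is a :: _ then tag a != t else true.

Definition wcons t (v : 'rV[int]_(d t)) w := if v == 0%R then w else syl v :: w.

Definition wact t (v : 'rV[int]_(d t)) w :=
  if w is a :: w' then
    if tag a == t then wcons (tagged_as (syl v) a + v)%R w' else wcons v w
  else wcons v w.

Lemma reduced_cons a w :
  reduced (a :: w) = [&& tagged a != 0%R, free_head (tag a) w & reduced w].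
Proof.
rewrite /reduced; case: w => [|b w] /=; first by rewrite !andbT.
by rewrite (eq_sym (tag a)); case: (tag b != tag a); rewrite -?andbA ?andbF.
Qed.

Lemma reduced_wcons t (v : 'rV[int]_(d t)) w :
  free_head t w -> reduced w -> reduced (wcons v w).
Proof. by rewrite /wcons; case: eqP => // /eqP v0 h r; rewrite reduced_cons /= v0 h. Qed.

Lemma wact_wcons t (u v : 'rV[int]_(d t)) w :
  free_head t w -> wact v (wcons u w) = wcons (u + v)%R w.
Proof.
rewrite /wcons; have [->|u0] := eqVneq u 0%R; last by rewrite /wact /= eqxx tagged_asE.
by rewrite add0r /wact; case: w => // a w /= /negPf->.
Qed.

Lemma reduced_wcons_split t w : reduced w ->
  exists (u : 'rV[int]_(d t)) w0, [/\ w = wcons u w0, free_head t w0 & reduced w0].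
Proof.
case: w => [|[s v] w] r; first by exists 0%R, [::]; rewrite /wcons eqxx.
have [e|st] := eqVneq s t; last by exists 0%R, (syl v :: w); rewrite /wcons eqxx.
case: t / e; exists v, w; have := r; rewrite reduced_cons => /and3P[/= v0 h rw].
by rewrite /wcons (negPf v0).
Qed.

Lemma reduced_wact t (v : 'rV[int]_(d t)) w : reduced w -> reduced (wact v w).
Proof.
by move=> /(reduced_wcons_split t)[u [w0 [-> h r]]]; rewrite wact_wcons // reduced_wcons.
Qed.

Lemma weval_wcons t (v : 'rV[int]_(d t)) w : weval (wcons v w) = weval w * i v.
Proof. by rewrite /wcons; case: eqP => // ->; rewrite (fp_inj0 iP) mulg1. Qed.

Lemma weval_wact t (v : 'rV[int]_(d t)) w : reduced w -> weval (wact v w) = weval w * i v.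
Proof.
move=> /(reduced_wcons_split t)[u [w0 [-> h r]]].
by rewrite wact_wcons // !weval_wcons (fp_morph iP) mulgA.
Qed.

(** Van der Waerden's argument: multiplication on the right is realised as an
    action on the reduced words. *)
Lemma normal_form : exists nf : G -> seq syllable,
  [/\ forall g, reduced (nf g), nf 1 = [::], cancel nf weval &
      forall t (v : 'rV[int]_(d t)) g, nf (g * i v) = wact v (nf g)].
Proof.
pose X := {w | reduced w}.
pose act t (v : 'rV[int]_(d t)) (x : X) : X := exist _ (wact v (val x)) (reduced_wact v (valP x)).
have act0 t x : act t 0%R x = x.
  apply: val_inj => /=; have [u [w0 [-> h r]]] := reduced_wcons_split t (valP x).
  by rewrite wact_wcons // addr0.
have actD t u v x : act t (u + v)%R x = act t v (act t u x).
  apply: val_inj => /=; have [u0 [w0 [-> h r]]] := reduced_wcons_split t (valP x).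
  by rewrite !wact_wcons // addrA.
have [A [A1 AM Ai]] := fp_act act0 actD.
pose x0 : X := exist _ [::] isT.
exists (fun g => val (A g x0)); split=> [g||g|t v g].
- exact: valP.
- by rewrite A1.
- have evA h x : weval (val (A h x)) = weval (val x) * h.
    move: h x; apply: (fp_ind iP) => [x|t v h IH x|[]]; first by rewrite A1 mulg1.
    by rewrite AM IH Ai /= weval_wact ?mulgA //; apply: valP.
  by rewrite evA /= mul1g.
- by rewrite AM Ai.
Qed.

Definition nf : G -> seq syllable := sval (cid normal_form).

Lemma nf_reduced g : reduced (nf g).
Proof. by rewrite /nf; case: cid => ? /= []. Qed.
Lemma nf1 : nf 1 = [::].
Proof. by rewrite /nf; case: cid => ? /= []. Qed.
Lemma nfK : cancel nf weval.
Proof. by rewrite /nf; case: cid => ? /= []. Qed.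
Lemma nfM t (v : 'rV[int]_(d t)) g : nf (g * i v) = wact v (nf g).
Proof. by rewrite /nf; case: cid => ? /= []. Qed.

Lemma wact_free t (v : 'rV[int]_(d t)) w : free_head t w -> wact v w = wcons v w.
Proof. by case: w => //= a w /negPf->. Qed.

Lemma wevalK w : reduced w -> nf (weval w) = w.
Proof.
elim: w => [|[t v] w IH]; rewrite ?nf1 // reduced_cons => /and3P[/= v0 h r].
by rewrite nfM IH // wact_free // /wcons (negPf v0).
Qed.

Lemma weval_inj w w' : reduced w -> reduced w' -> weval w = weval w' -> w = w'.
Proof. by move=> r r' e; rewrite -(wevalK r) e wevalK. Qed.

Lemma size_wcons t (v : 'rV[int]_(d t)) w : (size (wcons v w) <= (size w).+1)%N.
Proof. by rewrite /wcons; case: ifP. Qed.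

Lemma size_wact t (v : 'rV[int]_(d t)) w : (size (wact v w) <= (size w).+1)%N.
Proof.
case: w => [|a w]; rewrite /wact ?size_wcons //; case: ifP => _; rewrite ?size_wcons //.
by apply: leq_trans (size_wcons _ _) _; rewrite /= leqW.
Qed.

Lemma size_nf w : (size (nf (weval w)) <= size w)%N.
Proof.
by elim: w => [|[t v] w IH]; rewrite ?nf1 //= nfM; apply: leq_trans (size_wact _ _) _.
Qed.

Lemma size_nf_eq w : size (nf (weval w)) = size w -> nf (weval w) = w.
Proof.
elim: w => [|[t v] w IH]; rewrite ?nf1 //= nfM => sz.
have nfw : nf (weval w) = w.
  apply: IH; apply/eqP; rewrite eqn_leq size_nf -ltnS -sz; exact: size_wact.
move: sz; rewrite nfw /wact /wcons; case: (w) => [|a w'].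
  by case: ifP.
by case: ifP => _; case: ifP => //= _; lia.
Qed.

Lemma weval_cat w w' : weval (w ++ w') = weval w' * weval w.
Proof. by elim: w => [|a w IH] /=; rewrite ?mulg1 // IH mulgA. Qed.

Definition winverse w : seq syllable := rev (map (fun a => syl (- tagged a)%R) w).

Lemma weval_inverse w : weval (winverse w) = (weval w)^-1.
Proof.
elim: w => [|[t v] w IH]; first by rewrite invg1.
rewrite /winverse /= rev_cons -cats1 weval_cat -/(winverse w) IH /= mul1g.
by rewrite invgM fp_injN.
Qed.

Lemma winverse_reduced w : reduced w -> reduced (winverse w).
Proof.
case/andP=> a0 s; apply/andP; split.
  by rewrite all_rev all_map; apply: sub_all a0 => a /=; rewrite oppr_eq0.
rewrite /winverse map_rev rev_sorted -map_comp.
by rewrite (eq_sorted (e' := fun s t => s != t)) // => t t'; rewrite eq_sym.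
Qed.

Lemma reduced_cat w w' :
  reduced w -> reduced w' -> (forall b, ohead (rev w) = Some b -> free_head (tag b) w') ->
  reduced (w ++ w').
Proof.
elim: w => // a w IH; rewrite cat_cons !reduced_cons => /and3P[a0 h r] r' hb.
rewrite a0 IH //=; last first.
  by move=> b eb; apply: hb; rewrite rev_cons; case: (rev w) eb.
by rewrite andbT; case: w h hb {IH r} => [_ /(_ a) -> |b w].
Qed.

(** * Conjugates of the factors *)

Lemma factor_inj t (u v : 'rV[int]_(d t)) : i u = i v -> u = v.
Proof.
move=> e; have r (x : 'rV[int]_(d t)) : reduced (wcons x [::]) by apply: reduced_wcons.
have : wcons u [::] = wcons v [::] by apply: weval_inj => //; rewrite !weval_wcons e.
rewrite /wcons; case: eqP => [->|u0]; case: eqP => [->|v0] //.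
by case=> /eqP; rewrite -tag_eqE /tag_eq /= eqxx /= tagged_asE => /eqP.
Qed.

(** Write [x = x0 * u] with [u] in the factor [s] and [x0] not ending in it: the
    word [x0 * g * x0^-1] is reduced, so it has one syllable only if [x0 = 1]. *)
Lemma malnormal s t (g : 'rV[int]_(d s)) (h : 'rV[int]_(d t)) x :
  g != 0%R -> x * i g * x^-1 = i h -> s = t /\ exists u : 'rV[int]_(d s), x = i u.
Proof.
move=> g0 e; have [u [w0 [xw h0 r0]]] := reduced_wcons_split s (nf_reduced x).
have {xw}xE : x = weval w0 * i u by rewrite -[x]nfK xw weval_wcons.
have {}e : weval w0 * i g * (weval w0)^-1 = i h.
  rewrite -e xE invgM !mulgA; congr (_ * _).
  by rewrite -!mulgA; congr (_ * _); rewrite -fp_injN -!(fp_morph iP) addrCA subrr addr0.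
have r : reduced (winverse w0 ++ syl g :: w0).
  apply: reduced_cat; first exact: winverse_reduced.
    by rewrite reduced_cons /= g0 h0.
  by rewrite /winverse revK; case: (w0) h0 => //= a w; rewrite eq_sym => ? b [<-].
have ew : winverse w0 ++ syl g :: w0 = wcons h [::].
  apply: weval_inj => //; first exact: reduced_wcons.
  by rewrite weval_wcons weval_cat /= weval_inverse e mul1g.
have sz : (size w0 <= 0)%N.
  have := size_wcons h [::]; rewrite -ew size_cat size_rev size_map /=; lia.
move: sz ew xE; rewrite leqn0 => /nilP -> /=; rewrite /wcons mul1g.
by case: eqP => // _ [] st _ xu; split=> //; exists u.
Qed.

Lemma conj_factor_malnormal s t (g : 'rV[int]_(d s)) (h : 'rV[int]_(d t)) x y :
  g != 0%R -> x * i g * x^-1 = y * i h * y^-1 ->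
  s = t /\ exists u : 'rV[int]_(d s), x = y * i u.
Proof.
move=> g0 e; have [|st [u yx]] := @malnormal s t g h (y^-1 * x) g0.
  by apply: (mulgI y); apply: (mulIg y^-1); rewrite invgM invgK !mulgA mulgV mul1g mulgK.
by split=> //; exists u; rewrite -yx mulgA mulgV mul1g.
Qed.

(** * Commuting elements *)

Lemma weval_flatten n w : weval (flatten (nseq n w)) = weval w ^+ n.
Proof. by elim: n => [|n IH] //=; rewrite weval_cat IH expgSr. Qed.

(** The two powers commute and have the same length. *)
Lemma cat_commute (T : eqType) (u v : seq T) :
  u ++ v = v ++ u -> flatten (nseq (size v) u) = flatten (nseq (size u) v).
Proof.
have comm (x y : seq T) n : x ++ y = y ++ x ->
    flatten (nseq n x) ++ y = y ++ flatten (nseq n x).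
  move=> xy; elim: n => [|n IH] /=; first by rewrite cats0.
  by rewrite -catA IH !catA xy.
have sz (x : seq T) n : size (flatten (nseq n x)) = (n * size x)%N.
  by rewrite size_flatten /shape map_nseq sumn_nseq mulnC.
move=> uv; set U := flatten _; set V := flatten _.
have UV : U ++ V = V ++ U by do 2!(apply/esym/comm).
have sUV : size U = size V by rewrite !sz mulnC.
by have /eqP := UV; rewrite eqseq_cat // => /andP[/eqP].
Qed.

(** After a conjugation [x] is cyclically reduced. If it has at least two
    syllables, its first and last ones cannot both belong to the factor in which
    [y] ends, so that one of [x] and [x^-1] multiplies [y] on the right without
    cancellation; the products in the two orders are then the same reduced word,
    and the powers come from [cat_commute]. *)
Lemma commute_cases x y : commute x y -> x <> 1 ->
  (exists g t (u : 'rV[int]_(d t)), x = g * i u * g^-1) \/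
  (exists m k : nat, (0 < m)%N /\ (y ^+ m = x ^+ k \/ y ^+ m = x ^- k)).
Proof.
have word_case w v : reduced w -> reduced v -> reduced (w ++ v) ->
    weval w * weval v = weval v * weval w ->
    weval v ^+ size w = weval w ^+ size v.
  move=> rw rv rwv c; rewrite -!weval_flatten; congr weval; apply/esym/cat_commute.
  have e : nf (weval (v ++ w)) = w ++ v by rewrite weval_cat c -weval_cat wevalK.
  by rewrite -e size_nf_eq // e !size_cat addnC.
move: {2}(size (nf x)) (leqnn (size (nf x))) => n; elim: n x y => [|n IH] x y.
  by rewrite leqn0 => /nilP nx _; case; rewrite -[x]nfK nx.
move=> sx c x1; have rx := nf_reduced x; have xE := nfK x.
case: (lastP (nf x)) rx xE sx => [|w b] rx xE sx; first by case: x1; rewrite -xE.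
case: w rx xE sx => [|a w] rx xE sx.
  by left; exists 1, (tag b), (tagged b); rewrite -xE /= invg1 mulg1.
have [ab|nab] := eqVneq (tag a) (tag b).
  (* The outer syllables lie in the same factor: conjugating by one of them
     shortens the word. *)
  case: a b ab rx xE sx => [t a] [t' b] /= e; case: t' / e b => b rx xE sx.
  pose g := i a; pose J z := g * z * g^-1.
  have JM : {morph J : z z' / z * z'}.
    by move=> z z'; rewrite /J !mulgA; congr (_ * _ * _); rewrite mulgVK.
  have Jinj z z' : J z = J z' -> z = z' by move/mulIg/mulgI.
  have JXn z m : J (z ^+ m) = J z ^+ m.
    by elim: m => [|m IHm]; rewrite ?(morph_one JM) // !expgS JM IHm.
  have sJ : (size (nf (J x)) <= n)%N.
    have -> : J x = weval (rcons w (syl (b + a)%R)).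
      rewrite /J -xE /= -!cats1 !weval_cat /= !mul1g (addrC b) (fp_morph iP) -/g.
      by rewrite !mulgA mulgK.
    apply: leq_trans (size_nf _) _; rewrite size_rcons.
    by move: sx; rewrite /= size_rcons.
  have cJ : commute (J x) (J y) by rewrite /commute -!JM c.
  have J1 : J x <> 1 by rewrite -(morph_one JM) => /Jinj.
  have [[h [s [u e]]]|[m [k [m0 e]]]] := IH _ _ sJ cJ J1.
    left; exists (g^-1 * h), s, u; apply: Jinj; rewrite e /J.
    by rewrite invgM invgK !mulgA mulgV mul1g mulgK.
  right; exists m, k; split=> //; rewrite -!JXn in e.
  by case: e => [/Jinj|]; [left|rewrite -(morph_inv JM) => /Jinj; right].
right; set w1 := rcons _ _ in rx xE sx.
have w10 : (0 < size w1)%N by [].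
have xw : x = weval w1 by rewrite xE.
have w1b : ohead (rev w1) = Some b by rewrite /w1 rev_rcons.
have w1a : ohead (rev (winverse w1)) = Some (syl (- tagged a)%R) by rewrite /winverse revK.
have yE := nfK y; have ry := nf_reduced y.
have [hb|hb] := boolP (free_head (tag b) (nf y)).
  exists (size w1), (size (nf y)); split=> //; left.
  rewrite -{1}yE xw; apply: word_case => //; last by rewrite -xw yE.
  by apply: reduced_cat => // b'; rewrite w1b => -[<-].
exists (size w1), (size (nf y)); split=> //; right.
have wx : weval (winverse w1) = x^-1 by rewrite weval_inverse xw.
rewrite -expVgn -{1}yE -wx.
have -> : size w1 = size (winverse w1) by rewrite size_rev size_map.
apply: word_case => //; first exact: winverse_reduced.
  apply: reduced_cat => //; first exact: winverse_reduced.
  move=> b'; rewrite w1a => -[<-] /=.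
  by case: (nf y) hb => //= a' _; rewrite negbK => /eqP ->; rewrite eq_sym.
by rewrite wx yE; apply/esym/commuteV/commute_sym.
Qed.
End FreeProductOfFactors.

(** * Automorphisms and the noncyclic factors *)

Lemma additive_rowE n (V : zmodType) (f : 'rV[int]_n -> V) :
  {morph f : u v / (u + v)%R} ->
  forall v, f v = (\sum_k f (delta_mx ord0 k) *~ v ord0 k)%R.
Proof.
move=> fD v; have f0 : f 0%R = 0%R by apply: (addrI (f 0%R)); rewrite -fD !addr0.
have fN u : f (- u)%R = (- f u)%R by apply: (addrI (f u)); rewrite -fD !subrr.
have fMn u k : f (u *+ k)%R = (f u *+ k)%R.
  by elim: k => [|k IH]; rewrite ?mulr0n // !mulrS fD IH.
have fZ a u : f (a *: u)%R = (f u *~ a)%R.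
  have Zn k (x : 'rV[int]_n) : (Posz k *: x = x *+ k)%R by rewrite -scaler_nat natz.
  by case: a => k; rewrite ?NegzE ?scaleNr !Zn ?fN fMn ?mulrNz.
by rewrite {1}[v]row_sum_delta (big_morph f fD f0); apply: eq_bigr => k _; rewrite fZ.
Qed.

Section NoncyclicFactors.
Variables (G : groupType) (I : eqType) (d : I -> nat).
Variable i : forall t, 'rV[int]_(d t) -> G.
Hypothesis iP : is_fp i (of_void G).
Implicit Types (phi psi : autom G) (s t : I) (w : G).

Definition carries phi s w t :=
  forall v : 'rV[int]_(d s), exists u : 'rV[int]_(d t), phi (i v) = w * i u * w^-1.

Lemma automX phi x n : phi (x ^+ n) = phi x ^+ n.
Proof. by elim: n => [|n IH]; rewrite ?(morph_one (automM phi)) // !expgS automM IH. Qed.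

Lemma conj_factorD w t : {morph (fun u : 'rV[int]_(d t) => w * i u * w^-1) :
  u v / (u + v)%R >-> u * v}.
Proof. by move=> u v; rewrite (fp_morph iP) !mulgA mulgVK. Qed.

Lemma conj_factor_inj w t : injective (fun u : 'rV[int]_(d t) => w * i u * w^-1).
Proof. by move=> u v /mulIg/mulgI/(factor_inj iP). Qed.

(** The image of a basis vector [v0] is conjugate into a factor, since it and
    the image of a second basis vector have no common power; the image of the
    whole factor is then in the centraliser of that element. *)
Lemma carries_ex phi s : (1 < d s)%N -> exists w t, carries phi s w t.
Proof.
move=> ds; pose v0 : 'rV[int]_(d s) := delta_mx ord0 (Ordinal (ltnW ds)).
pose v1 : 'rV[int]_(d s) := delta_mx ord0 (Ordinal ds).
have v00 : v0 != 0%R.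
  by apply/eqP => /matrixP /(_ ord0 (Ordinal (ltnW ds))); rewrite !mxE !eqxx.
have comm (u v : 'rV[int]_(d s)) : commute (phi (i u)) (phi (i v)).
  by rewrite /commute -!automM -!(fp_morph iP) addrC.
have injphi (u v : 'rV[int]_(d s)) : phi (i u) = phi (i v) -> u = v.
  by move=> e; apply: (factor_inj iP); rewrite -[LHS](automK phi) e automK.
have phi0 : phi (i v0) <> 1.
  rewrite -(morph_one (automM phi)) -(fp_inj0 iP s) => /injphi.
  exact/eqP.
have [[w [t [u e]]]|[m [k [m0 e]]]] := commute_cases iP (comm v0 v1) phi0.
  exists w, t => v.
  have u0 : u != 0%R.
    by apply/eqP => u0; apply: phi0; rewrite e u0 (fp_inj0 iP) mulg1 mulgV.
  have [|_ [u' e']] := @conj_factor_malnormal _ _ _ _ iP t t u u (phi (i v) * w) w u0.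
    rewrite -e invgM !mulgA; have -> : phi (i v) * w * i u / w = phi (i v) * phi (i v0).
      by rewrite e !mulgA.
    by rewrite -(comm v0 v) mulgK.
  by exists u'; rewrite -e' mulgK.
have [k' /matrixP/(_ ord0 (Ordinal ds))] : exists k' : int, (v1 *+ m = v0 *~ k')%R.
  case: e => e; [exists (Posz k)|exists (- Posz k)%R]; apply: injphi.
    by rewrite pmulrn (fp_injMn iP) !automX e -automX -(fp_injMn iP).
  rewrite (fp_injMn iP) !automX e mulrNz -pmulrn (fp_injN iP) (fp_injMn iP).
  by rewrite (morph_inv (automM phi)) automX.
rewrite -scaler_int !mulmxnE !mxE !eqxx /= mulr0 => /eqP.
by rewrite pnatr_eq0 (gtn_eqF m0).
Qed.

Lemma factor_vec_neq0 s : (0 < d s)%N -> exists v : 'rV[int]_(d s), v != 0%R.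
Proof.
move=> ds; exists (delta_mx ord0 (Ordinal ds)); apply/eqP.
by move/matrixP/(_ ord0 (Ordinal ds)); rewrite !mxE !eqxx.
Qed.

Lemma carries_unique phi s w w' t t' : (0 < d s)%N ->
  carries phi s w t -> carries phi s w' t' ->
  t = t' /\ exists u : 'rV[int]_(d t), w = w' * i u.
Proof.
move=> /factor_vec_neq0[v v0] /(_ v)[u e] /(_ v)[u' e'].
apply: (conj_factor_malnormal iP (g := u) (h := u')); last by rewrite -e.
apply: contraNneq v0 => u0; apply/eqP/(factor_inj iP)/(can_inj (@automK _ phi)).
by rewrite e u0 !(fp_inj0 iP) mulg1 mulgV (morph_one (automM phi)).
Qed.

Lemma carries_comp phi psi s w t w' t' :
  carries psi s w t -> carries phi t w' t' -> carries (phi * psi) s (phi w * w') t'.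
Proof.
move=> c c' v; have [u e] := c v; have [u' e'] := c' u; exists u'.
rewrite -[(phi * psi) _]/(phi (psi _)) e !automM (morph_inv (automM phi)) e'.
by rewrite invgM !mulgA.
Qed.

Lemma carries1 s : carries (1 : autom G) s 1 s.
Proof. by move=> v; exists v; rewrite invg1 mulg1 mul1g. Qed.

(** Everything in the carried conjugate comes from the factor: its preimage
    commutes with a nontrivial element of the factor. *)
Lemma carries_onto phi s w t : (0 < d s)%N -> carries phi s w t ->
  forall u : 'rV[int]_(d t), exists v : 'rV[int]_(d s), phi (i v) = w * i u * w^-1.
Proof.
move=> ds c u; have [v0 v00] := factor_vec_neq0 ds; have [u0 e0] := c v0.
pose y := autom_inv phi (w * i u * w^-1).
have yE : phi y = w * i u * w^-1 by rewrite autom_invK.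
have [|_ [v yv]] := malnormal iP (t := s) (x := y) (h := v0) v00.
  apply: (can_inj (@automK _ phi)); rewrite !automM (morph_inv (automM phi)) yE e0.
  by rewrite -(conj_factorD w) addrC (conj_factorD w) mulgK.
by exists v; rewrite -yv yE.
Qed.

Lemma carries_rank phi s w t : (0 < d s)%N -> carries phi s w t -> d s = d t.
Proof.
move=> ds c; have c' := carries_onto ds c.
pose f v := sval (cid (c v)); pose g u := sval (cid (c' u)).
have fE v : phi (i v) = w * i (f v) * w^-1 := svalP (cid (c v)).
have gE u : phi (i (g u)) = w * i u * w^-1 := svalP (cid (c' u)).
have iphi (u v : 'rV[int]_(d s)) : phi (i u) = phi (i v) -> u = v.
  by move/(can_inj (@automK _ phi))/(factor_inj iP).
have fD : {morph f : u v / (u + v)%R}.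
  by move=> u v; apply: (@conj_factor_inj w); rewrite conj_factorD -!fE -automM -(fp_morph iP).
have gD : {morph g : u v / (u + v)%R}.
  by move=> u v; apply: iphi; rewrite (fp_morph iP) automM !gE conj_factorD.
have fK : cancel f g by move=> v; apply: iphi; rewrite gE -fE.
have gK : cancel g f by move=> u; apply: (@conj_factor_inj w); rewrite -fE gE.
pose mx m n (h : 'rV[int]_m -> 'rV[int]_n) : 'M[int]_(m, n) :=
  (\matrix_k h (delta_mx ord0 k))%R.
have mxE' m n (h : 'rV[int]_m -> 'rV[int]_n) :
    {morph h : u v / (u + v)%R} -> forall v, h v = (v *m mx m n h)%R.
  move=> hD v; rewrite (additive_rowE hD) mulmx_sum_row; apply: eq_bigr => k _.
  by rewrite rowK -scaler_int intz.
have trE : (\tr (mx _ _ f *m mx _ _ g) = \tr (1%:M : 'M[int]_(d s)))%R.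
  congr mxtrace; apply/row_matrixP => k.
  by rewrite !rowE mulmxA -(mxE' _ _ f fD) -(mxE' _ _ g gD) fK mulmx1.
have trE' : (\tr (mx _ _ g *m mx _ _ f) = \tr (1%:M : 'M[int]_(d t)))%R.
  congr mxtrace; apply/row_matrixP => k.
  by rewrite !rowE mulmxA -(mxE' _ _ g gD) -(mxE' _ _ f fD) gK mulmx1.
have : (\tr (1%:M : 'M[int]_(d s)) = \tr (1%:M : 'M[int]_(d t)))%R.
  by rewrite -trE -trE' mxtrace_mulC.
by rewrite !mxtrace1 => /eqP; rewrite eqr_nat => /eqP.
Qed.

(** The chosen conjugator and target factor, meaningful on the factors of rank
    at least two only. *)
Definition carrier phi s : G * I :=
  if pselect (exists p : G * I, carries phi s p.1 p.2) is left e then sval (cid e) else (1, s).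

Lemma carrierP phi s : (1 < d s)%N ->
  carries phi s (carrier phi s).1 (carrier phi s).2.
Proof.
move=> ds; rewrite /carrier; case: pselect => [e|[]]; first exact: svalP (cid e).
by have [w [t c]] := carries_ex phi ds; exists (w, t).
Qed.
End NoncyclicFactors.

Local Open Scope ring_scope.

(** * Abelianisation and Fox derivatives *)

(** The binomial coefficient [z] choose [2]. *)
Definition binz (z : int) : int := ((z * (z - 1)) %/ 2)%Z.

Lemma binzE z : binz z * 2 = z * (z - 1).
Proof.
rewrite /binz divzK //; have := divz_eq z 2; set k := (z %/ 2)%Z.
have [m0|m1] : (z %% 2)%Z = 0 \/ (z %% 2)%Z = 1.
- have := ltz_pmod z (isT : (0 < 2 :> int)); have := modz_ge0 z (isT : 2 != 0 :> int); lia.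
- by rewrite m0 addr0 => ->; rewrite -mulrA mulrCA dvdz_mulr.
- by rewrite m1 => ->; rewrite addrK mulrA mulrC dvdz_mulr.
Qed.

Lemma binzD x y : binz (x + y) = binz x + binz y + x * y.
Proof.
apply: (@mulIf _ 2) => //.
rewrite binzE !mulrDl !binzE; ring.
Qed.

(** Coordinate [l] of a vector, zero when out of range: [l] may come from a
    vector of another length. *)
Definition vcoord n (v : 'rV[int]_n) (l : nat) : int := oapp (v ord0) 0 (insub l).

Lemma vcoordE n (v : 'rV[int]_n) (l : 'I_n) : vcoord v l = v ord0 l.
Proof. by rewrite /vcoord valK. Qed.

Lemma vcoordD n (u v : 'rV[int]_n) l : vcoord (u + v) l = vcoord u l + vcoord v l.
Proof. by rewrite /vcoord; case: insub => [k|] /=; rewrite ?mxE ?addr0. Qed.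

Lemma vcoord0 n l : vcoord (0 : 'rV[int]_n) l = 0.
Proof. by rewrite /vcoord; case: insub => [k|] //=; rewrite mxE. Qed.

Lemma vcoord_const n (a : int) l : (l < n)%N -> vcoord (const_mx a : 'rV[int]_n) l = a.
Proof. by move=> ln; rewrite /vcoord insubT /= mxE. Qed.

Section Abelianisation.
Variables (G : groupType) (E : nat) (d : 'I_E -> nat).
Variable i : forall t, 'rV[int]_(d t) -> G.
Hypothesis iP : is_fp i (of_void G).

Definition Lam := {t : 'I_E & 'I_(d t)}.
Definition ix t (l : 'I_(d t)) : Lam := Tagged (fun t => 'I_(d t)) l.
Implicit Types (s t : 'I_E) (g h w : G) (lam mu : Lam) (phi psi : autom G).

Definition emb t (v : 'rV[int]_(d t)) (lam : Lam) : int :=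
  if tag lam == t then vcoord v (tagged lam) else 0.

Lemma emb0 t lam : emb (0 : 'rV[int]_(d t)) lam = 0.
Proof. by rewrite /emb vcoord0 if_same. Qed.

Lemma embD t (u v : 'rV[int]_(d t)) lam : emb (u + v) lam = emb u lam + emb v lam.
Proof. by rewrite /emb vcoordD; case: ifP; rewrite ?addr0. Qed.

Lemma embE t (v : 'rV[int]_(d t)) (l : 'I_(d t)) : emb v (ix l) = v ord0 l.
Proof. by rewrite /emb /= eqxx vcoordE. Qed.

Lemma emb_neq t (v : 'rV[int]_(d t)) lam : tag lam != t -> emb v lam = 0.
Proof. by rewrite /emb => /negPf->. Qed.

Lemma emb_sum t (v : 'rV[int]_(d t)) (F : Lam -> int) :
  \sum_mu emb v mu * F mu = \sum_l v ord0 l * F (ix l).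
Proof.
rewrite (eq_bigr (fun mu => emb v (ix (tagged mu)) * F (ix (tagged mu)))); last by case.
rewrite -(sig_big_dep (J := fun t => 'I_(d t)) xpredT (fun _ _ => true) (fun s l => emb v (ix l) * F (ix l))) /=.
rewrite (bigD1 t) //= [X in _ + X]big1 ?addr0 => [|s st].
  by apply: eq_bigr => l _; rewrite embE.
by apply: big1 => l _; rewrite emb_neq // mul0r.
Qed.

Lemma abelianisation : exists ab : G -> Lam -> int,
  [/\ forall lam, ab 1%g lam = 0, forall g h lam, ab (g * h)%g lam = ab g lam + ab h lam
    & forall t (v : 'rV[int]_(d t)) lam, ab (i v) lam = emb v lam].
Proof.
pose act t (v : 'rV[int]_(d t)) (x : Lam -> int) lam := x lam + emb v lam.
have [||A [A1 AM Ai]] := fp_act iP (a := act).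
- by move=> t x; apply/funext => lam; rewrite /act emb0 addr0.
- by move=> t u v x; apply/funext => lam; rewrite /act embD addrA.
have A0 g x lam : A g x lam = x lam + A g (fun=> 0) lam.
  move: g x lam; apply: (fp_ind iP) => [x lam|t v g IH x lam|[]]; first by rewrite !A1 addr0.
  rewrite !AM !Ai IH [in RHS]IH /act; ring.
exists (fun g => A g (fun=> 0)); split=> [lam|g h lam|t v lam].
- by rewrite A1.
- by rewrite AM A0.
- by rewrite Ai /act add0r.
Qed.

Definition ab : G -> Lam -> int := sval (cid abelianisation).

Lemma ab1 lam : ab 1%g lam = 0.
Proof. by rewrite /ab; case: cid => ? /= []. Qed.
Lemma abM g h lam : ab (g * h)%g lam = ab g lam + ab h lam.
Proof. by rewrite /ab; case: cid => ? /= []. Qed.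
Lemma ab_i t (v : 'rV[int]_(d t)) lam : ab (i v) lam = emb v lam.
Proof. by rewrite /ab; case: cid => ? /= []. Qed.

Lemma abV g lam : ab g^-1%g lam = - ab g lam.
Proof. by apply: (addrI (ab g lam)); rewrite -abM mulgV ab1 subrr. Qed.

Lemma abJ g h lam : ab (g * h * g^-1)%g lam = ab h lam.
Proof. by rewrite !abM abV addrAC addrC subrr addr0. Qed.

Definition bvec lam : G := i (delta_mx ord0 (tagged lam)).

Lemma ab_bvec mu lam : ab (bvec mu) lam = (mu == lam)%:R.
Proof.
rewrite /bvec ab_i; case: mu lam => t l [s k] /=; have [st|st] := eqVneq s t.
  by case: t / st l => l; rewrite embE mxE eqxx /= eq_Tagged /= eq_sym.
rewrite emb_neq //; case: eqP => // /(congr1 (@tag _ _)) /= /eqP.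
by rewrite eq_sym (negPf st).
Qed.

Lemma ab_surj (h : Lam -> int) : exists g, ab g =1 h.
Proof.
pose p (r : seq 'I_E) := (\prod_(t <- r) i (\row_(l < d t) h (ix l)))%g.
exists (p (index_enum 'I_E)) => lam.
have -> r : ab (p r) lam = \sum_(t <- r) emb (\row_(l < d t) h (ix l)) lam.
  elim: r => [|t r IH]; first by rewrite /p !big_nil ab1.
  by rewrite /p !big_cons abM -/(p r) IH ab_i.
rewrite (bigD1 (tag lam)) //= big1 => [|t tl]; last by rewrite emb_neq // eq_sym.
by rewrite addr0 /emb eqxx vcoordE mxE; case: (lam).
Qed.

(** The matrix of the action of an automorphism on the abelianisation. *)
Definition Phi phi mu lam : int := ab (phi (bvec mu)) lam.

Lemma ab_autom phi g lam : ab (phi g) lam = \sum_mu ab g mu * Phi phi mu lam.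
Proof.
move: g; apply: (fp_ind iP) => [|t v g IH|[]].
  by rewrite (morph_one (automM phi)) ab1 big1 // => mu _; rewrite ab1 mul0r.
rewrite automM abM IH; under [in RHS]eq_bigr do rewrite abM mulrDl.
rewrite big_split; congr (_ + _); under [in RHS]eq_bigr do rewrite ab_i.
rewrite emb_sum (additive_rowE (f := fun v => ab (phi (i v)) lam)); last first.
  by move=> u u' /=; rewrite (fp_morph iP) automM abM.
by apply: eq_bigr => l _; rewrite -mulrzr intz mulrC.
Qed.

(** The augmented Fox derivative, that is the exponent of the generator of the
    factor [t]; only the cyclic factors carry one. *)
Definition eps t g : int := if d t == 1%N then \sum_(l < d t) ab g (ix l) else 0.

Lemma epsE t g lam : d t = 1%N -> tag lam = t -> eps t g = ab g lam.
Proof.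
case: lam => s l /= dt st; case: t / st dt => dt.
rewrite /eps ifT; last exact/eqP.
rewrite (bigD1 l) //= big1 ?addr0 // => k /eqP[]; apply: val_inj => /=.
by have := ltn_ord k; have := ltn_ord l; lia.
Qed.

Lemma epsM t g h : eps t (g * h)%g = eps t g + eps t h.
Proof.
by rewrite /eps; case: ifP; rewrite ?addr0 // -big_split => _; apply: eq_bigr => l _; rewrite abM.
Qed.

Lemma eps1 t : eps t 1%g = 0.
Proof. by rewrite /eps; case: ifP => // _; rewrite big1 // => l _; rewrite ab1. Qed.

Lemma epsV t g : eps t g^-1%g = - eps t g.
Proof. by apply: (addrI (eps t g)); rewrite -epsM mulgV eps1 subrr. Qed.

Lemma eps_i t s (v : 'rV[int]_(d s)) :
  eps t (i v) = if (s == t) && (d t == 1%N) then vcoord v 0 else 0.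
Proof.
have [dt|dt] := eqVneq (d t) 1%N; last by rewrite /eps andbF (negPf dt).
have l0 : (0 < d t)%N by rewrite dt.
by rewrite (@epsE t _ (ix (Ordinal l0))) // ab_i /emb /= eq_sym andbT.
Qed.

(** In the group ring of the abelianisation modulo the square of the
    augmentation ideal, the Fox derivative of [g] along a cyclic factor [t]
    has constant term [eps t g] and a linear term [fox t g] in the
    abelianisation. Along a factor of rank at least two, with which goes the
    derivation sending [h] in the factor to [1 - h], only the linear term is
    left. *)
Lemma fox_derivative : exists fox : 'I_E -> G -> Lam -> int,
  (forall t g h lam, fox t (g * h)%g lam = fox t g lam + fox t h lam + eps t h * ab g lam) /\
  (forall t s (v : 'rV[int]_(d s)) lam, fox t (i v) lam =
    if s == t then if d t == 1%N then binz (vcoord v 0) * (tag lam == t)%:R else - emb v lam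
    else 0).
Proof.
suff H t : exists fox : G -> Lam -> int,
  (forall g h lam, fox (g * h)%g lam = fox g lam + fox h lam + eps t h * ab g lam) /\
  (forall s (v : 'rV[int]_(d s)) lam, fox (i v) lam =
    if s == t then if d t == 1%N then binz (vcoord v 0) * (tag lam == t)%:R else - emb v lam
    else 0).
  exists (fun t => sval (cid (H t))).
  by split=> t; have [] := svalP (cid (H t)).
have [dt|dt] := eqVneq (d t) 1%N; last first.
  exists (fun g lam => - (if tag lam == t then ab g lam else 0)); split.
    move=> g h lam; rewrite abM /eps (negPf dt) mul0r addr0.
    by case: ifP => _; rewrite ?subr0 // opprD.
  move=> s v lam; rewrite ab_i; have [st|st] := eqVneq s t.
    by case: ifP => // /negbT ls; rewrite emb_neq ?st.
  by case: eqP => [lt|]; rewrite ?oppr0 // emb_neq ?oppr0 // lt eq_sym.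
(* The derivative of [x^n] is [1 + x + ... + x^(n - 1)], whose linear term is
   the binomial coefficient times [x]. *)
pose act s (v : 'rV[int]_(d s)) (x : (Lam -> int) * (Lam -> int)) :=
  (fun lam => x.1 lam + emb v lam,
   fun lam => x.2 lam + if s == t then vcoord v 0 * x.1 lam + binz (vcoord v 0) * (tag lam == t)%:R else 0).
have [||A [A1 AM Ai]] := fp_act iP (a := act).
- move=> s [x y]; congr (_, _); apply/funext => lam /=; first by rewrite emb0 addr0.
  by rewrite vcoord0 /binz mul0r div0z !mul0r addr0 if_same addr0.
- move=> s u v [x y]; congr (_, _); apply/funext => lam /=; first by rewrite embD addrA.
  case: eqP => [st|]; last by rewrite !addr0.
  have -> : emb u lam = vcoord u 0 * (tag lam == t)%:R.
    rewrite /emb -st; case: eqP => [ls|]; rewrite ?mulr0 // mulr1; congr (vcoord _ _).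
    by have := ltn_ord (tagged lam); rewrite {2}ls st dt; case: (nat_of_ord _).
  rewrite vcoordD binzD; ring.
have A0 g x : A g x = (fun lam => x.1 lam + ab g lam,
    fun lam => x.2 lam + (A g (fun=> 0, fun=> 0)).2 lam + eps t g * x.1 lam).
  move: g x; apply: (fp_ind iP) => [[x y]|s v g IH [x y]|[]].
    by rewrite !A1; congr (_, _); apply/funext => lam /=; rewrite ?ab1 ?eps1 ?mul0r ?addr0.
  rewrite !AM !Ai IH [in RHS]IH; congr (_, _); apply/funext => lam /=.
    by rewrite abM ab_i; ring.
  rewrite epsM eps_i dt eqxx andbT /=; case: ifP => _; ring.
exists (fun g => (A g (fun=> 0, fun=> 0)).2); split=> [g h lam|s v lam].
  rewrite AM A0 /= [in RHS](A0 g) /= [in LHS](A0 g) /=; ring.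
by rewrite Ai /= add0r mulr0 add0r.
Qed.

Definition fox : 'I_E -> G -> Lam -> int := sval (cid fox_derivative).

Lemma foxM t g h lam : fox t (g * h)%g lam = fox t g lam + fox t h lam + eps t h * ab g lam.
Proof. by rewrite /fox; case: cid => ? /= []. Qed.

Lemma fox_i t s (v : 'rV[int]_(d s)) lam : fox t (i v) lam =
  if s == t then if d t == 1%N then binz (vcoord v 0) * (tag lam == t)%:R else - emb v lam
  else 0.
Proof. by rewrite /fox; case: cid => ? /= []. Qed.

Lemma fox1 t lam : fox t 1%g lam = 0.
Proof.
have := foxM t 1 1 lam; rewrite mulg1 eps1 mul0r addr0 => e.
by apply: (addrI (fox t 1%g lam)); rewrite -e addr0.
Qed.

Lemma foxV t g lam : fox t g^-1%g lam = - fox t g lam + eps t g * ab g lam.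
Proof.
apply: (addrI (fox t g lam)); apply: (addIr (eps t g^-1%g * ab g lam)).
rewrite -foxM mulgV fox1 epsV; ring.
Qed.

Lemma foxJ t g h lam :
  fox t (g * h * g^-1)%g lam = fox t h lam + eps t h * ab g lam - eps t g * ab h lam.
Proof. rewrite !foxM foxV !epsV !abM; ring. Qed.

Lemma fox_rank_gt1 t g lam : d t != 1%N ->
  fox t g lam = - (if tag lam == t then ab g lam else 0).
Proof.
move=> dt; move: g; apply: (fp_ind iP) => [|s v g IH|[]].
  by rewrite fox1 ab1 if_same oppr0.
rewrite foxM IH abM fox_i /eps (negPf dt) mul0r addr0 ab_i.
have [st|st] := eqVneq s t; case: ifPn => lt; rewrite ?subr0 ?opprD //.
  by rewrite emb_neq ?st // oppr0 subr0.
by rewrite (emb_neq (t := s)) ?(eqP lt) 1?eq_sym // oppr0.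
Qed.
End Abelianisation.

(** * The crossed homomorphism *)

Section ConjAutom.
Variable G : groupType.
Implicit Types g h : G.

Lemma conj_automM g : {morph (fun x => g * x * g^-1)%g : x y / (x * y)%g}.
Proof. by move=> x y; rewrite !mulgA; congr (_ * _ * _)%g; rewrite mulgVK. Qed.

Lemma conj_automK g : cancel (fun x => g * x * g^-1)%g (fun x => g^-1 * x * g)%g.
Proof. by move=> x; rewrite !mulgA mulVg mul1g mulgVK. Qed.

Lemma conj_automVK g : cancel (fun x => g^-1 * x * g)%g (fun x => g * x * g^-1)%g.
Proof. by move=> x; rewrite !mulgA mulgV mul1g mulgK. Qed.

Definition conj_autom g : autom G := Autom (conj_automM g) (@conj_automK g) (@conj_automVK g).

Lemma conj_automV g : (conj_autom g)^-1%g = conj_autom g^-1%g.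
Proof. by apply: automP => x; rewrite /= invgK. Qed.

Lemma inner_conj g : inner (conj_autom g).
Proof. by exists g^-1%g => x; rewrite conjgE invgK mulgA. Qed.

Lemma innerP (f : autom G) : inner f -> exists g, f = conj_autom g.
Proof.
by case=> h fh; exists h^-1%g; apply: automP => x; rewrite fh conjgE /= invgK mulgA.
Qed.
End ConjAutom.

Section CrossedHom.
Variables (G : groupType) (E : nat) (d : 'I_E -> nat).
Hypothesis d_gt0 : forall t, (0 < d t)%N.
Variable i : forall t, 'rV[int]_(d t) -> G.
Hypothesis iP : is_fp i (of_void G).
Implicit Types (s t : 'I_E) (g h w : G) (phi psi : autom G).
Local Notation Lam := (Lam d).
Implicit Types (lam mu : Lam).
Local Notation ab := (ab iP).
Local Notation eps := (eps iP).
Local Notation fox := (fox iP).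
Local Notation Phi := (Phi iP).

Definition xgen t : G := i (const_mx 1 : 'rV[int]_(d t)).

(** Row [s] of the Jacobian of an automorphism, split into its constant and its
    linear terms. A factor of rank at least two that is carried to
    [w * i t * w^-1] contributes the Fox derivative of [w] plus [w] times the
    basis vector [t]; this sum does not change when [w] is multiplied on the right
    by an element of the factor [t]. *)
Definition jac0 phi s t : int :=
  if d s == 1%N then eps t (phi (xgen s))
  else eps t (carrier i phi s).1 + (t == (carrier i phi s).2)%:R.

Definition jac1 phi s t lam : int :=
  if d s == 1%N then fox t (phi (xgen s)) lam
  else fox t (carrier i phi s).1 lam + (t == (carrier i phi s).2)%:R * ab (carrier i phi s).1 lam.

Lemma rank_gt1 t : d t != 1%N -> (1 < d t)%N.
Proof. by have := d_gt0 t; case: (d t) => [|[]]. Qed.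

Lemma jac_carries phi s w t0 : d s != 1%N -> carries i phi s w t0 ->
  (forall t, jac0 phi s t = eps t w + (t == t0)%:R) /\
  (forall t lam, jac1 phi s t lam = fox t w lam + (t == t0)%:R * ab w lam).
Proof.
move=> ds c; have c1 := carrierP iP phi (rank_gt1 ds).
have [e [u we]] := carries_unique iP (d_gt0 s) c1 c.
have dt0 : d t0 != 1%N by rewrite -(carries_rank iP (d_gt0 s) c).
rewrite /jac0 /jac1 (negPf ds); move: u we c1; rewrite e {e} => u -> c1; split=> t.
  by rewrite epsM eps_i; case: eqP => [<-|]; rewrite ?(negPf dt0) ?addr0 // addr0.
move=> lam; rewrite foxM abM fox_i ab_i eps_i; have [<-|t0t] := eqVneq t0 t.
  rewrite (negPf dt0) /=; ring.
rewrite /=; ring.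
Qed.

Lemma eps_xgen s t : d s = 1%N -> eps t (xgen s) = (s == t)%:R.
Proof.
move=> ds; rewrite eps_i vcoord_const //.
by case: eqP => // <-; rewrite ds.
Qed.

Lemma fox_xgen s t lam : d s = 1%N -> fox t (xgen s) lam = 0.
Proof.
move=> ds; rewrite fox_i vcoord_const //.
by rewrite /binz subrr mulr0 div0z mul0r; case: eqP => // <-; rewrite ifT //; apply/eqP.
Qed.

Definition push phi (h : Lam -> int) lam : int := \sum_mu h mu * Phi phi mu lam.

Lemma push_ab phi g lam : push phi (ab g) lam = ab (phi g) lam.
Proof. by rewrite /push -ab_autom. Qed.

Lemma pushD phi (h h' : Lam -> int) lam : push phi (fun mu => h mu + h' mu) lam = push phi h lam + push phi h' lam.
Proof. by rewrite /push -big_split; apply: eq_bigr => mu _; rewrite mulrDl. Qed.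

Lemma pushZ phi (a : int) (h : Lam -> int) lam : push phi (fun mu => a * h mu) lam = a * push phi h lam.
Proof. by rewrite /push mulr_sumr; apply: eq_bigr => mu _; rewrite mulrA. Qed.

Lemma eq_push phi (h h' : Lam -> int) lam : h =1 h' -> push phi h lam = push phi h' lam.
Proof. by move=> e; apply: eq_bigr => mu _; rewrite e. Qed.

(** Both sides obey the same product rule in [g], so the generators suffice; on
    a factor of rank at least two both sides expand the Fox derivative of a
    conjugate by [w] of an element of the target factor. *)
Lemma jac_chain phi g :
  (forall t, eps t (phi g) = \sum_s eps s g * jac0 phi s t) /\
  (forall t lam, fox t (phi g) lam =
     \sum_s (eps s g * jac1 phi s t lam + jac0 phi s t * push phi (fox s g) lam)).
Proof.
pose C g := (forall t, eps t (phi g) = \sum_s eps s g * jac0 phi s t) /\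
  (forall t lam, fox t (phi g) lam =
     \sum_s (eps s g * jac1 phi s t lam + jac0 phi s t * push phi (fox s g) lam)).
have C1 : C 1%g.
  rewrite /C (morph_one (automM phi)); split=> t => [|lam].
    by rewrite eps1 big1 // => s _; rewrite eps1 mul0r.
  rewrite fox1 big1 // => s _; rewrite eps1 mul0r add0r /push big1 ?mulr0 // => mu _.
  by rewrite fox1 mul0r.
have CM g1 g2 : C g1 -> C g2 -> C (g1 * g2)%g.
  move=> [e1 f1] [e2 f2]; rewrite /C automM; split=> t => [|lam].
    by rewrite epsM e1 e2 -big_split; apply: eq_bigr => s _; rewrite epsM mulrDl.
  rewrite foxM f1 f2 e2 mulr_suml -!big_split; apply: eq_bigr => s _ /=.
  rewrite epsM (eq_push _ _ (foxM iP s g1 g2)) !pushD pushZ push_ab; ring.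
have CV g1 : C g1 -> C g1^-1%g.
  move=> [e1 f1]; rewrite /C (morph_inv (automM phi)); split=> t => [|lam].
    by rewrite epsV e1 -sumrN; apply: eq_bigr => s _; rewrite epsV mulNr.
  rewrite foxV f1 e1 mulr_suml -sumrN -big_split; apply: eq_bigr => s _ /=.
  have -> : push phi (fox s g1^-1%g) lam =
      push phi (fun mu => (-1) * fox s g1 mu + eps s g1 * ab g1 mu) lam.
    by apply: eq_push => mu; rewrite foxV mulN1r.
  rewrite epsV pushD !pushZ push_ab; ring.
move: g; apply: (fp_ind iP) => // [r v g Cg]; apply: (CM) => // {g Cg}.
have [dr|dr] := eqVneq (d r) 1%N.
  have Cx : C (xgen r).
    split=> t => [|lam].
      rewrite (bigD1 r) //= big1 ?addr0 => [|s sr]; first by rewrite eps_xgen // eqxx mul1r /jac0 dr eqxx.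
      by rewrite eps_xgen // eq_sym (negPf sr) mul0r.
    have p0 s : push phi (fox s (xgen r)) lam = 0.
      by rewrite /push big1 // => mu _; rewrite fox_xgen // mul0r.
    rewrite (bigD1 r) //= big1 ?addr0 => [|s sr].
      by rewrite eps_xgen // eqxx mul1r /jac1 dr eqxx p0 mulr0 addr0.
    by rewrite eps_xgen // p0 eq_sym (negPf sr) mul0r mulr0 addr0.
  have CX n : C (xgen r ^+ n)%g.
    by elim: n => [|n IH]; rewrite ?expg0 // expgS; apply: CM.
  have r0 := d_gt0 r.
  have vE : v = const_mx (v ord0 (Ordinal r0)).
    apply/rowP => l; rewrite mxE; congr (v _ _); apply: val_inj => /=.
    by have := ltn_ord l; rewrite {2}dr; case: (nat_of_ord l).
  have cN n : const_mx (Posz n) = (const_mx 1 : 'rV[int]_(d r)) *+ n.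
    by apply/rowP => l; rewrite mulmxnE !mxE natz.
  rewrite vE; case: (v _ _) => n; first by rewrite cN (fp_injMn iP).
  rewrite NegzE (_ : const_mx _ = - const_mx (Posz n.+1) :> 'rV[int]_(d r)).
    by rewrite cN (fp_injN iP) (fp_injMn iP); apply: CV.
  by apply/rowP => l; rewrite !mxE.
have [w [t0 c]] := carries_ex iP phi (rank_gt1 dr).
have [j0 j1] := jac_carries dr c; have [u e] := c v.
have dt0 : d t0 != 1%N by rewrite -(carries_rank iP (d_gt0 r) c).
have abE lam : ab (phi (i v)) lam = ab (i u) lam by rewrite e abJ.
have epsv s : eps s (i v) = 0 by rewrite eps_i; case: eqP => // <-; rewrite (negPf dr).
have epsu s : eps s (i u) = 0 by rewrite eps_i; case: eqP => // <-; rewrite (negPf dt0).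
split=> t => [|lam].
  rewrite big1 => [|s _]; last by rewrite epsv mul0r.
  by rewrite e !epsM epsu epsV addr0 subrr.
rewrite (bigD1 r) //= big1 ?addr0 => [|s sr]; last first.
  rewrite epsv mul0r add0r /push big1 ?mulr0 // => mu _.
  by rewrite fox_i eq_sym (negPf sr) mul0r.
rewrite epsv mul0r add0r (eq_push _ (h' := fun mu => (-1) * ab (i v) mu)); last first.
  by move=> mu; rewrite fox_i eqxx (negPf dr) ab_i mulN1r.
rewrite pushZ push_ab abE {1}e foxJ epsu mul0r addr0 j0 fox_i ab_i.
have [<-|_] := eqVneq t0 t; first by rewrite (negPf dt0) /=; ring.
rewrite /=; ring.
Qed.

(** If [psi] carries the factor [s] to [v * r * v^-1] and [phi] carries [r] to
    [w * t * w^-1], the conjugator of the composite is [phi v * w], whose Fox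
    derivative is given by the chain rule. *)
Lemma jacM phi psi s :
  (forall t, jac0 (phi * psi)%g s t = \sum_r jac0 psi s r * jac0 phi r t) /\
  (forall t lam, jac1 (phi * psi)%g s t lam = \sum_r (jac0 psi s r * jac1 phi r t lam +
      jac0 phi r t * push phi (jac1 psi s r) lam)).
Proof.
have [ds|ds] := eqVneq (d s) 1%N.
  have [c0 c1] := jac_chain phi (psi (xgen s)).
  by rewrite /jac0 /jac1 ds eqxx.
have [v [r c]] := carries_ex iP psi (rank_gt1 ds).
have dr : d r != 1%N by rewrite -(carries_rank iP (d_gt0 s) c).
have [w [t0 c']] := carries_ex iP phi (rank_gt1 dr).
have [j0 j1] := jac_carries ds c; have [j0' j1'] := jac_carries dr c'.
have [j0'' j1''] := jac_carries ds (carries_comp c c').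
have [ch0 ch1] := jac_chain phi v.
have delta (F : 'I_E -> int) : \sum_q (q == r)%:R * F q = F r.
  by rewrite (bigD1 r) //= eqxx mul1r big1 ?addr0 // => q /negPf->; rewrite mul0r.
split=> t => [|lam].
  rewrite j0'' epsM ch0; under [RHS]eq_bigr do rewrite j0 mulrDl.
  by rewrite big_split /= (delta (fun q => jac0 phi q t)) j0' addrA.
rewrite j1'' foxM abM ch1.
have -> : \sum_q (jac0 psi s q * jac1 phi q t lam + jac0 phi q t * push phi (jac1 psi s q) lam) =
    \sum_q (eps q v * jac1 phi q t lam + jac0 phi q t * push phi (fox q v) lam) +
    \sum_q (q == r)%:R * (jac1 phi q t lam + jac0 phi q t * ab (phi v) lam).
  rewrite -big_split; apply: eq_bigr => q _ /=.
  rewrite j0 (eq_push _ _ (j1 q)) pushD pushZ push_ab; ring.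
rewrite delta j1' j0'; ring.
Qed.

(** * Traces of Jacobians *)

Variables (al : nat -> nat -> int).
Hypothesis alP : (forall t, d t != 1%N) \/ (forall j k j' k', al j k = al j' k').

Definition jacmx phi : 'M[int]_E := \matrix_(s, t) jac0 phi s t.
Definition foxmx phi lam : 'M[int]_E := \matrix_(s, t) jac1 phi s t lam.
Definition weight lam : 'M[int]_E := diag_mx (\row_t al (d (tag lam)) (d t)).

(** The linear term of the determinant of the Jacobian, divided by the constant
    term. When no factor is cyclic, the constant term of the Jacobian is a
    permutation that preserves the ranks, so the ranks can be weighted
    independently of one another. *)
Definition crossed phi lam : int := \tr (jacmx phi^-1%g *m foxmx phi lam *m weight lam).

Lemma jacmxM phi psi : jacmx (phi * psi)%g = jacmx psi *m jacmx phi.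
Proof.
apply/matrixP => s t; rewrite !mxE (jacM phi psi s).1.
by apply: eq_bigr => r _; rewrite !mxE.
Qed.

Lemma jacmx1 : jacmx 1%g = 1%:M.
Proof.
apply/matrixP => s t; rewrite !mxE eq_sym; have [ds|ds] := eqVneq (d s) 1%N.
  by rewrite /jac0 ds eqxx eps_xgen // eq_sym.
by rewrite (jac_carries ds (@carries1 _ _ _ i s)).1 eps1 add0r.
Qed.

Lemma jacmxV phi : jacmx phi *m jacmx phi^-1%g = 1%:M.
Proof. by rewrite -jacmxM mulVg jacmx1. Qed.

Lemma jacmxVl phi : jacmx phi^-1%g *m jacmx phi = 1%:M.
Proof. by rewrite -jacmxM mulgV jacmx1. Qed.

Lemma foxmxM phi psi lam : foxmx (phi * psi)%g lam =
  jacmx psi *m foxmx phi lam + \sum_mu Phi phi mu lam *: (foxmx psi mu *m jacmx phi).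
Proof.
apply/matrixP => s t; rewrite [LHS]mxE (jacM phi psi s).2 big_split mxE; congr (_ + _).
  by rewrite mxE; apply: eq_bigr => r _; rewrite !mxE.
rewrite summxE; under [RHS]eq_bigr do rewrite !mxE mulr_sumr.
rewrite exchange_big; apply: eq_bigr => r _ /=; rewrite /push mulr_sumr.
apply: eq_bigr => mu _; rewrite !mxE; ring.
Qed.

Lemma jacmx_weight phi lam : jacmx phi *m weight lam = weight lam *m jacmx phi.
Proof.
apply/matrixP => s t; rewrite mul_mx_diag mul_diag_mx !mxE mulrC.
case: alP => [d1|al_cst]; last by rewrite (al_cst _ (d t) (d (tag lam)) (d s)).
have [w [t0 c]] := carries_ex iP phi (rank_gt1 (d1 s)).
rewrite (jac_carries (d1 s) c).1 /eps (negPf (d1 t)) add0r.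
by case: eqP => [->|]; rewrite ?mulr0 // (carries_rank iP (d_gt0 s) c).
Qed.

Lemma Phi_rank phi mu lam :
  d (tag mu) != 1%N -> Phi phi mu lam != 0 -> d (tag lam) = d (tag mu).
Proof.
move=> d1; have [w [t0 c]] := carries_ex iP phi (rank_gt1 d1).
have [u e] := c (delta_mx ord0 (tagged mu)).
rewrite /Phi /bvec e abJ ab_i (carries_rank iP (d_gt0 _) c); case: (eqVneq (tag lam) t0) => [->//|lt0].
by rewrite emb_neq ?eqxx.
Qed.

Lemma Phi_weight phi mu lam : Phi phi mu lam *: weight lam = Phi phi mu lam *: weight mu.
Proof.
have [->|P0] := eqVneq (Phi phi mu lam) 0; first by rewrite !scale0r.
congr (_ *: diag_mx _); apply/rowP => t; rewrite !mxE.
case: alP => [d1|al_cst]; last exact: al_cst.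
by rewrite (Phi_rank (d1 _) P0).
Qed.

(** The chain rule splits the linear term in two, and the trace of each loses
    the factors of the Jacobian that are conjugated around it. *)
Lemma crossedM phi psi lam :
  crossed (phi * psi)%g lam = crossed phi lam + push phi (crossed psi) lam.
Proof.
rewrite /crossed invgM jacmxM foxmxM mulmxDr mulmxDl mxtraceD; congr (_ + _).
  rewrite -!mulmxA; congr (\tr (_ *m _)).
  by rewrite !mulmxA jacmxVl mul1mx.
rewrite mulmx_sumr mulmx_suml raddf_sum; apply: eq_bigr => mu _ /=.
rewrite -scalemxAr -scalemxAl mxtraceZ -!mulmxA jacmx_weight mxtrace_mulC -!mulmxA.
rewrite jacmxV mulmx1 mulmxA -mxtraceZ scalemxAr Phi_weight -scalemxAr mxtraceZ.
by rewrite mulmxA mulrC.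
Qed.

(** On the inner automorphism by [g] the trace counts each factor [s] once,
    except that the component of [g] in the factor [s] itself is lost. *)
Lemma crossed_conj g lam : crossed (conj_autom g) lam =
  (\sum_s al (d (tag lam)) (d s) - al (d (tag lam)) (d (tag lam))) * ab g lam.
Proof.
have carries_conj h s : carries i (conj_autom h) s h s by move=> v; exists v.
have j0 h s t : jac0 (conj_autom h) s t =
    (s == t)%:R + (if d s == 1%N then 0 else eps t h).
  have [ds|ds] := eqVneq (d s) 1%N.
    by rewrite /jac0 ds eqxx /= !epsM epsV eps_xgen // addrAC subrr add0r addr0.
  by rewrite (jac_carries ds (carries_conj h s)).1 addrC eq_sym.
rewrite /crossed /mxtrace (eq_bigr (fun s => al (d (tag lam)) (d s) *
    (ab g lam - (if tag lam == s then ab g lam else 0)))) => [|s _].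
  rewrite mulrBl mulr_suml; under eq_bigr do rewrite mulrBr.
  rewrite sumrB; congr (_ - _); rewrite (bigD1 (tag lam)) //= eqxx big1 ?addr0 // => s.
  by rewrite eq_sym => /negPf ->; rewrite mulr0.
rewrite mul_mx_diag !mxE mulrC; congr (_ * _); rewrite conj_automV.
under eq_bigr do rewrite !mxE j0 mulrDl; rewrite big_split (bigD1 s) //= eqxx mul1r.
rewrite big1 ?addr0 => [|t]; last by rewrite eq_sym => /negPf ->; rewrite mul0r.
have [ds|ds] := eqVneq (d s) 1%N.
  rewrite [X in _ + X]big1 ?addr0 => [|t _]; last by rewrite mul0r.
  rewrite /jac1 ds eqxx /= foxJ fox_xgen // add0r eps_xgen // eqxx mul1r; congr (_ - _).
  rewrite ab_i /emb; case: eqP => [ls|_]; last by rewrite mulr0.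
  have s0 : tagged lam = 0%N :> nat.
    by have := ltn_ord (tagged lam); rewrite {2}ls ds; case: (nat_of_ord _).
  rewrite (epsE iP g ds ls) s0.
  by rewrite vcoord_const // mulr1.
rewrite [X in _ + X]big1 ?addr0 => [|t _].
  by rewrite (jac_carries ds (carries_conj g s)).2 eqxx mul1r fox_rank_gt1 // addrC.
rewrite epsV; have [dt|dt] := eqVneq (d t) 1%N; last first.
  by rewrite /eps (negPf dt) oppr0 mul0r.
rewrite /jac1 dt eqxx /= foxJ fox_xgen // add0r eps_xgen //.
have ts : t != s by apply: contraNneq ds => <-; rewrite dt.
by rewrite (negPf ts) mul0r sub0r /eps (negPf ds) mul0r oppr0 mulr0.
Qed.
End CrossedHom.

Local Open Scope group_scope.

(** * Restriction to a characteristic subgroup *)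

Section OutEmbedding.
Variables (G T : groupType) (Psi : T -> G) (K : G -> Prop) (D : autom G -> Prop).
Hypothesis PsiM : {morph Psi : x y / x * y}.
Hypothesis Psi_inj : injective Psi.
Hypothesis PsiK : forall x, K (Psi x).
Hypothesis K_Psi : forall g, K g -> exists x, Psi x = g.
Hypothesis K_char : forall (phi : autom G) g, K g -> K (phi g).
Hypothesis DM : forall phi psi, D phi -> D psi -> D (phi * psi).
Hypothesis DV : forall phi, D phi -> D phi^-1.
Hypothesis D_ex : forall phi, exists g, D (conj_autom g * phi).
Hypothesis D_conj : forall g, D (conj_autom g) -> K g.
Hypothesis K_cent : (forall g, K g) \/
  (forall c, (forall k, K k -> c * k = k * c) -> c = 1).

Definition unPsi g : T := if pselect (exists x, Psi x = g) is left e then sval (cid e) else 1.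

Lemma unPsiK g : K g -> Psi (unPsi g) = g.
Proof. by move=> /K_Psi e; rewrite /unPsi; case: pselect => // e'; apply: (svalP (cid e')). Qed.

Definition res_fun (phi : autom G) x := unPsi (phi (Psi x)).

Lemma Psi_res_fun phi x : Psi (res_fun phi x) = phi (Psi x).
Proof. by rewrite unPsiK //; apply/K_char/PsiK. Qed.

Lemma res_funM phi : {morph res_fun phi : x y / x * y}.
Proof. by move=> x y; apply: Psi_inj; rewrite Psi_res_fun !PsiM automM !Psi_res_fun. Qed.

Lemma res_funK phi : cancel (res_fun phi) (res_fun phi^-1).
Proof. by move=> x; apply: Psi_inj; rewrite !Psi_res_fun; apply: automK. Qed.

Lemma res_funVK phi : cancel (res_fun phi^-1) (res_fun phi).
Proof. by move=> x; apply: Psi_inj; rewrite !Psi_res_fun; apply: autom_invK. Qed.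

Definition res phi : autom T := Autom (res_funM phi) (@res_funK phi) (@res_funVK phi).

Lemma Psi_res phi x : Psi (res phi x) = phi (Psi x). Proof. exact: Psi_res_fun. Qed.

Lemma resM phi psi : res (phi * psi) = res phi * res psi.
Proof. by apply: automP => x; apply: Psi_inj; rewrite -[(res phi * _) x]/(res phi (res psi x)) !Psi_res. Qed.

Lemma outE (H : groupType) (f g : autom H) :
  \pi_(Out H) f = \pi_(Out H) g <-> exists h, f = conj_autom h * g.
Proof.
split=> [/pi_outP/innerP[h e]|[h ->]]; first by exists h; rewrite -e mulgVK.
by apply/pi_outP; rewrite mulgK; apply: inner_conj.
Qed.

Lemma res_conj x psi : res (conj_autom (Psi x) * psi) = conj_autom x * res psi.
Proof.
apply: automP => z; apply: Psi_inj; rewrite Psi_res.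
by rewrite -[(conj_autom x * _) z]/(x * res psi z * x^-1) !PsiM (morph_inv PsiM) Psi_res.
Qed.

Lemma out_res_D phi psi : D phi -> D psi ->
  \pi_(Out G) phi = \pi_(Out G) psi -> \pi_(Out T) (res phi) = \pi_(Out T) (res psi).
Proof.
move=> Dphi Dpsi /outE[g e]; have /D_conj/K_Psi[x xg] : D (conj_autom g).
  by rewrite -[conj_autom g](mulgK psi) -e; apply: DM => //; apply: DV.
by apply/outE; exists x; rewrite e -xg res_conj.
Qed.

Definition D_repr phi : autom G := conj_autom (sval (cid (D_ex phi))) * phi.

Lemma D_reprP phi : D (D_repr phi). Proof. exact: (svalP (cid (D_ex phi))). Qed.

Lemma out_D_repr phi : \pi_(Out G) (D_repr phi) = \pi_(Out G) phi.
Proof. by apply/outE; exists (sval (cid (D_ex phi))). Qed.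

Definition out_res (x : Out G) : Out T := \pi_(Out T) (res (D_repr (repr x))).

Lemma out_resE phi : D phi -> out_res (\pi_(Out G) phi) = \pi_(Out T) (res phi).
Proof.
by move=> Dphi; apply: out_res_D => //; rewrite ?out_D_repr ?reprK //; apply: D_reprP.
Qed.

Lemma out_D x : exists2 phi, D phi & x = \pi_(Out G) phi.
Proof. by exists (D_repr (repr x)); rewrite ?out_D_repr ?reprK //; apply: D_reprP. Qed.

Lemma out_resM : {morph out_res : x y / x * y}.
Proof.
move=> x y; have [phi Dphi ->] := out_D x; have [psi Dpsi ->] := out_D y.
by rewrite pi_outM !out_resE ?resM ?pi_outM //; apply: DM.
Qed.

(** Two automorphisms that agree on [K] differ at [u] by an element commuting
    with the image of [K], since [K] is normal. *)
Lemma res_eq phi psi : res phi = res psi -> phi = psi.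
Proof.
move=> e; have eK k : K k -> phi k = psi k.
  by move=> /K_Psi[x <-]; rewrite -!Psi_res e.
case: K_cent => [Kall|cent]; apply: automP => u; first exact: eK.
apply: (mulgI (psi u)^-1); rewrite mulVg; apply: cent => k Kk.
have [k' k'E] : exists k', k = phi k' by exists (phi^-1 k); rewrite [RHS](autom_invK phi).
have Kk' : K k' by rewrite -[k'](automK phi) -k'E; apply: (K_char phi^-1).
have := eK _ (K_char (conj_autom u) Kk').
rewrite /= !automM (morph_inv (automM phi)) (morph_inv (automM psi)) -(eK k') // -k'E => c.
apply: (mulIg (phi u)^-1); apply: (mulgI (psi u)); rewrite !mulgA mulgV mul1g c.
by rewrite mulgK.
Qed.

Lemma out_res_inj : injective out_res.
Proof.
move=> x y; have [phi Dphi ->] := out_D x; have [psi Dpsi ->] := out_D y.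
rewrite !out_resE // => /outE[t e]; apply/outE; exists (Psi t).
by apply: res_eq; rewrite res_conj.
Qed.

Lemma out_embedding : exists f : {multiplicative Out G -> Out T}, injective f.
Proof.
pose f : {multiplicative Out G -> Out T} :=
  HB.pack out_res (isMultiplicative.Build _ _ out_res out_resM).
by exists f; apply: out_res_inj.
Qed.
End OutEmbedding.

Local Open Scope ring_scope.

(** * The structure of the congruence subgroup *)

Section Residues.
Variables (E : nat) (d : 'I_E -> nat) (rho : 'I_E -> nat).
Hypothesis rho_gt0 : forall t, (0 < rho t)%N.
Local Notation Lam := (Lam d).
Implicit Types (s t : 'I_E) (lam : Lam) (h : Lam -> int).

Definition residues := {dffun forall lam : Lam, 'I_(rho (tag lam))}.
HB.instance Definition _ := Finite.on residues.
Implicit Types a b : residues.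

Lemma residue_lt h lam : (`|(h lam %% rho (tag lam))%Z| < rho (tag lam))%N.
Proof.
have := rho_gt0 (tag lam); move: (rho _) => n n0.
have := ltz_pmod (h lam) (n0 : 0 < n%:Z); have := modz_ge0 (h lam) (lt0r_neq0 (n0 : 0 < n%:Z)).
by case: (modz _ _) => // m _; rewrite ltz_nat.
Qed.

Definition red h : residues := [ffun lam => Ordinal (residue_lt h lam)].
Definition resval a lam : int := nat_of_ord (a lam).

Lemma resval_red h lam : resval (red h) lam = (h lam %% rho (tag lam))%Z.
Proof. by rewrite /resval ffunE /= gez0_abs // modz_ge0 // -lt0n. Qed.

Lemma resval_mod a lam : (resval a lam %% rho (tag lam))%Z = resval a lam.
Proof. by rewrite modz_small // /resval /= ltz_nat ltn_ord. Qed.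

Lemma resval_div a lam : (resval a lam %/ rho (tag lam))%Z = 0.
Proof. by rewrite divz_small // /resval /= ltz_nat ltn_ord. Qed.

Lemma resval_inj a b : resval a =1 resval b -> a = b.
Proof. by move=> e; apply/ffunP => lam; apply: val_inj; case: (e lam). Qed.

Definition cut (P : pred Lam) a := red (fun lam => if P lam then resval a lam else 0).

Lemma resval_cut (P : pred Lam) a lam : resval (cut P a) lam = if P lam then resval a lam else 0.
Proof. by rewrite resval_red; case: ifP => _; rewrite ?resval_mod // mod0z. Qed.

Definition res0 := red (fun=> 0).
Lemma resval_res0 lam : resval res0 lam = 0. Proof. by rewrite resval_red mod0z. Qed.

Definition zero_on (P : pred Lam) a := [forall lam, P lam ==> (resval a lam == 0)].
Lemma zero_onP (P : pred Lam) a : reflect (forall lam, P lam -> resval a lam = 0) (zero_on P a).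
Proof.
by apply: (iffP forallP) => z lam; [move/(implyP (z lam))/eqP|apply/implyP => /z ->].
Qed.

Definition inblock t : pred Lam := fun lam => tag lam == t.
Definition later t : pred Lam := fun lam => (t < tag lam)%N.
Definition rep t a := cut (predC (inblock t)) a.

Lemma rep_zero t a : zero_on (inblock t) (rep t a).
Proof. by apply/zero_onP => lam bl; rewrite resval_cut /= bl. Qed.

Lemma rep_id t a : zero_on (inblock t) a -> rep t a = a.
Proof.
move=> /zero_onP z; apply: resval_inj => lam; rewrite resval_cut /=.
by case: ifPn => // /negPn /z ->.
Qed.
End Residues.

Section Kurosh.
Variables (G : groupType) (E : nat) (d : 'I_E -> nat).
Variable i : forall t, 'rV[int]_(d t) -> G.
Hypothesis iP : is_fp i (of_void G).
Variable rho : 'I_E -> nat.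
Hypothesis rho_gt0 : forall t, (0 < rho t)%N.
Local Notation Lam := (Lam d).
Local Notation ab := (ab iP).
Local Notation A := (residues d rho).
Local Notation red := (red rho_gt0).
Local Notation rep := (rep rho_gt0).
Implicit Types (s t : 'I_E) (lam : Lam) (g h : G) (a b : A).

Definition act a g : A := red (fun lam => resval a lam + ab g lam).

Lemma act1 a : act a 1%g = a.
Proof. by apply: resval_inj => lam; rewrite resval_red ab1 addr0 resval_mod. Qed.

Lemma actM a g h : act a (g * h)%g = act (act a g) h.
Proof. by apply: resval_inj => lam; rewrite !resval_red abM addrA modzDml. Qed.

(** A vertex of the covering graph, that is a coset of the factor [t], is
    represented by its member with zero coordinates in that factor; the edges of
    [is_tree] form a maximal tree, whose geodesic to [a] changes the
    coordinates one factor after another. *)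
Definition is_tree t a := zero_on (inblock t) a || zero_on (@later E d t) a.

Definition cosets := {p : 'I_E * A | zero_on (inblock p.1) p.2}.
Definition loops := {p : 'I_E * A | ~~ is_tree p.1 p.2}.
Definition coset_rank (j : cosets) := d (val j).1.

Variables (T : groupType) (iT : forall j : cosets, 'rV[int]_(coset_rank j) -> T).
Variable yT : loops -> T.
Hypothesis TP : is_fp iT yT.

Definition vertex_elt t a (v : 'rV[int]_(d t)) : T :=
  @iT (exist (fun p : 'I_E * A => zero_on (inblock p.1) p.2) (t, rep t a)
    (rep_zero rho_gt0 t a)) v.

(** The edge from the coset of [a] to [a]. *)
Definition edge t a : T := if insub (t, a) is Some y then yT y else 1%g.

Lemma edge_tree t a : is_tree t a -> edge t a = 1%g.
Proof. by move=> tr; rewrite /edge insubF //= tr. Qed.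

Lemma vertex_elt_rep t a b (v : 'rV[int]_(d t)) : rep t a = rep t b -> vertex_elt a v = vertex_elt b v.
Proof.
rewrite /vertex_elt; move: (rep_zero _ t a) (rep_zero _ t b) => za zb e.
by move: za zb; rewrite e => za zb; rewrite (Prop_irrelevance za zb).
Qed.

Lemma vertex_eltD t a : {morph (@vertex_elt t a) : u v / (u + v) >-> (u * v)%g}.
Proof. by move=> u v; rewrite /vertex_elt (fp_morph TP). Qed.

Lemma vertex_elt0 t a : vertex_elt a (0 : 'rV[int]_(d t)) = 1%g.
Proof. by rewrite /vertex_elt; apply: (fp_inj0 TP). Qed.

Lemma rep_act t a (v : 'rV[int]_(d t)) : rep t (act a (i v)) = rep t a.
Proof.
apply: resval_inj => lam; rewrite !resval_cut /=; case: ifPn => // nb.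
by rewrite resval_red ab_i emb_neq // addr0 resval_mod.
Qed.

Definition blockv t a : 'rV[int]_(d t) := \row_l resval a (ix l).

Definition carry t a (v : 'rV[int]_(d t)) : 'rV[int]_(d t) :=
  \row_l ((resval a (ix l) + v ord0 l) %/ rho t)%Z.

Lemma carryD t a (u v : 'rV[int]_(d t)) : carry a (u + v) = carry a u + carry (act a (i u)) v.
Proof.
apply/rowP => l; rewrite !mxE resval_red ab_i embE /= addrA.
rewrite {1}(divz_eq (resval a (ix l) + u ord0 l) (rho t)) -addrA divzMDl //.
by rewrite -lt0n.
Qed.

Lemma carry_eq t a (v : 'rV[int]_(d t)) :
  blockv t a + v = (rho t)%:Z *: carry a v + blockv t (act a (i v)).
Proof.
apply/rowP => l; rewrite !mxE resval_red ab_i embE /= mulrC; exact: divz_eq.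
Qed.

(** The path along [v] from the vertex [a]: to the coset of [a], around the
    corresponding factor of [T], and back to the vertex [a + v]. *)
Definition step t a (v : 'rV[int]_(d t)) : T :=
  ((edge t a)^-1 * vertex_elt a (carry a v) * edge t (act a (i v)))%g.

(** The steps of one factor compose, so they define an action on pairs of a
    vertex and an element of [T]; free products act as soon as their factors do. *)
Lemma cocycle : exists path_class : A -> G -> T,
  [/\ forall a, path_class a 1%g = 1%g, forall a g h, path_class a (g * h)%g = (path_class a g * path_class (act a g) h)%g
    & forall t (v : 'rV[int]_(d t)) a, path_class a (i v) = step a v].
Proof.
pose tr t (v : 'rV[int]_(d t)) (x : A * T) := (act x.1 (i v), x.2 * step x.1 v)%g.
have [||B [B1 BM Bi]] := fp_act iP (a := tr).
- move=> t [a x]; rewrite /tr /step /= (fp_inj0 iP) act1; congr (_, _).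
  rewrite (_ : carry a 0 = 0) ?vertex_elt0 ?mulg1 ?mulVg ?mulg1 //.
  by apply/rowP => l; rewrite !mxE addr0; apply: (resval_div a (ix l)).
- move=> t u v [a x]; rewrite /tr /= (fp_morph iP) actM; congr (_, _).
  rewrite /step (fp_morph iP) actM carryD vertex_eltD (vertex_elt_rep _ (rep_act a u)).
  by rewrite !mulgA; congr (_ * _ * _)%g; rewrite mulgK.
have B0 g a x : B g (a, x) = (act a g, x * (B g (a, 1%g)).2)%g.
  move: g a x; apply: (fp_ind iP) => [a x|t v g IH a x|[]].
    by rewrite !B1 act1 mulg1.
  rewrite !BM !Bi /tr /= mul1g IH actM; congr (_, _).
  by rewrite [in RHS]IH /= -mulgA.
exists (fun a g => (B g (a, 1%g)).2); split=> [a|a g h|t v a].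
- by rewrite B1.
- by rewrite BM [B g _]B0 mul1g B0.
- by rewrite Bi /tr mul1g.
Qed.

Definition path_class : A -> G -> T := sval (cid cocycle).
Lemma path_class1 a : path_class a 1%g = 1%g.
Proof. by rewrite /path_class; case: cid => ? /= []. Qed.
Lemma path_classM a g h : path_class a (g * h)%g = (path_class a g * path_class (act a g) h)%g.
Proof. by rewrite /path_class; case: cid => ? /= []. Qed.
Lemma path_class_i t (v : 'rV[int]_(d t)) a : path_class a (i v) = step a v.
Proof. by rewrite /path_class; case: cid => ? /= []. Qed.

Lemma path_classV a g : path_class a g^-1%g = (path_class (act a g^-1%g) g)^-1%g.
Proof.
apply: (mulIg (path_class (act a g^-1%g) g)).
by rewrite -path_classM mulVg path_class1 mulVg.
Qed.

(** * Geodesics of the maximal tree *)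

Definition geo_step a (n : nat) : G := if insub n is Some t then i (blockv t a) else 1%g.
Definition geodesic a (n : nat) : G := (\prod_(0 <= m < n) geo_step a m)%g.

Lemma geo_stepE a t : geo_step a t = i (blockv t a).
Proof. by rewrite /geo_step valK. Qed.

Lemma blockv_zero t a : zero_on (inblock t) a -> blockv t a = 0.
Proof. by move/zero_onP => z; apply/rowP => l; rewrite !mxE z // /inblock /= eqxx. Qed.

Lemma blockv_rep s t a : s != t -> blockv s (rep t a) = blockv s a.
Proof. by move=> st; apply/rowP => l; rewrite !mxE resval_cut /= st. Qed.

Lemma geodesic_split t a : exists w,
  [/\ geodesic a E = (geodesic a t * i (blockv t a) * w)%g, geodesic (rep t a) E = (geodesic a t * w)%g
    & zero_on (@later E d t) a -> w = 1%g].
Proof.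
exists (\prod_(t.+1 <= m < E) geo_step a m)%g.
have split3 b : geodesic b E = (geodesic b t * i (blockv t b) * \prod_(t.+1 <= m < E) geo_step b m)%g.
  by rewrite {1}/geodesic (big_cat_nat _ (n := t.+1)) //= big_nat_recr //= geo_stepE.
split; first exact: split3.
  rewrite split3 blockv_zero ?rep_zero // (fp_inj0 iP) mulg1; congr (_ * _)%g.
    apply: eq_big_nat => m /andP[_ mt]; rewrite /geo_step; case: insubP => // s _ sm.
    by rewrite blockv_rep // -val_eqE /= sm (ltn_eqF mt).
  apply: eq_big_nat => m /andP[mt _]; rewrite /geo_step; case: insubP => // s _ sm.
  by rewrite blockv_rep // -val_eqE /= sm (gtn_eqF mt).
move/zero_onP => z; rewrite big_nat big1 // => m /andP[tm _].
rewrite /geo_step; case: insubP => // s _ sm.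
rewrite blockv_zero ?(fp_inj0 iP) //; apply/zero_onP => lam /eqP ls; apply: z.
by rewrite /later ls sm.
Qed.

Lemma ab_geodesic a lam : ab (geodesic a E) lam = resval a lam.
Proof.
have H n : (n <= E)%N -> ab (geodesic a n) lam = if (tag lam < n)%N then resval a lam else 0.
  elim: n => [|n IH] nE; first by rewrite /geodesic big_nil ab1.
  rewrite /geodesic big_nat_recr //= -/(geodesic a n) abM IH; last exact: ltnW.
  rewrite (geo_stepE a (Ordinal nE)) ab_i /emb -val_eqE /= ltnS.
  case: (ltngtP (tag lam) n) => [_|_|e]; rewrite ?addr0 ?add0r //.
  have tE : tag lam = Ordinal nE by apply: val_inj.
  by rewrite -tE vcoordE mxE; case: (lam).
by rewrite H // ltn_ord.
Qed.

Lemma act_geodesic a n : (n <= E)%N ->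
  act (res0 d rho_gt0) (geodesic a n) = cut rho_gt0 (fun lam => (tag lam < n)%N) a.
Proof.
elim: n => [|n IH] nE.
  by rewrite /geodesic big_nil act1; apply: resval_inj => lam; rewrite [RHS]resval_cut [LHS]resval_res0.
rewrite /geodesic big_nat_recr //= -/(geodesic a n) actM IH; last exact: ltnW.
apply: resval_inj => lam; rewrite resval_red !resval_cut (geo_stepE a (Ordinal nE)) ab_i.
rewrite /emb -val_eqE /= ltnS; case: (ltngtP (tag lam) n) => [_|_|e].
- by rewrite addr0 resval_mod.
- by rewrite addr0 mod0z.
have tE : tag lam = Ordinal nE by apply: val_inj.
by rewrite -tE vcoordE mxE add0r (resval_mod a (ix (tagged lam))); case: (lam).
Qed.

Lemma path_class_geodesic a : path_class (res0 d rho_gt0) (geodesic a E) = 1%g.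
Proof.
have H n : (n <= E)%N -> path_class (res0 d rho_gt0) (geodesic a n) = 1%g.
  elim: n => [|n IH] nE; first by rewrite /geodesic big_nil path_class1.
  rewrite /geodesic big_nat_recr //= -/(geodesic a n) path_classM IH ?mul1g; last exact: ltnW.
  have nE' := ltnW nE; rewrite act_geodesic // (geo_stepE a (Ordinal nE)) path_class_i /step.
  set b := cut _ _ a.
  have -> : carry b (blockv (Ordinal nE) a) = 0.
    apply/rowP => l; rewrite !mxE resval_cut /= ltnn add0r; exact: (resval_div a (ix l)).
  have zb : zero_on (inblock (Ordinal nE)) b.
    by apply/zero_onP => lam /eqP e; rewrite resval_cut e /= ltnn.
  rewrite vertex_elt0 (edge_tree (t := Ordinal nE)) ?invg1 ?mul1g; last by rewrite /is_tree zb.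
  apply: edge_tree; apply/orP; right; apply/zero_onP => lam nl.
  rewrite resval_red resval_cut ab_i emb_neq; last by rewrite -val_eqE /= (gtn_eqF nl).
  by rewrite ltnNge (ltnW nl) addr0 mod0z.
exact: H.
Qed.

(** * The two inverse isomorphisms *)

(** A generator of [T] is sent to the loop that reaches its coset or edge along
    the tree, runs through it, and returns along the tree. The formula for edges
    also holds in the tree, where this loop is trivial. *)
Lemma from_generators : exists Psi : T -> G,
  [/\ {morph Psi : x y / (x * y)%g},
      forall t a (v : 'rV[int]_(d t)),
        Psi (vertex_elt a v) = (geodesic (rep t a) E * i ((rho t)%:Z *: v) * (geodesic (rep t a) E)^-1)%g,
      forall (j : cosets) (v : 'rV[int]_(coset_rank j)),
        Psi (@iT j v) = (geodesic (val j).2 E * i ((rho (val j).1)%:Z *: v) * (geodesic (val j).2 E)^-1)%g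
    & forall t a, Psi (edge t a) =
        (geodesic (rep t a) E * i (blockv t a) * (geodesic a E)^-1)%g].
Proof.
pose hi (j : cosets) (v : 'rV[int]_(coset_rank j)) :=
  (geodesic (val j).2 E * i ((rho (val j).1)%:Z *: v) * (geodesic (val j).2 E)^-1)%g.
have hiD j : {morph hi j : u v / (u + v) >-> (u * v)%g}.
  by move=> u v; rewrite /hi scalerDr (fp_morph iP) !mulgA mulgVK.
pose hy (y : loops) := let: (t, a) := val y in
  (geodesic (rep t a) E * i (blockv t a) * (geodesic a E)^-1)%g.
have [Psi [PsiM Psii Psiy]] := fp_lift TP hy hiD.
exists Psi; split=> // [t a v|t a]; first by rewrite Psii.
rewrite /edge; case: insubP => [y _ ya|]; first by rewrite Psiy /hy ya.
rewrite (morph_one PsiM) /= => /negPn.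
have [w [-> -> w1]] := geodesic_split t a.
by case/orP=> [/blockv_zero->|/w1->]; rewrite ?(fp_inj0 iP) !mulg1 mulgV.
Qed.

Definition Psi : T -> G := sval (cid from_generators).
Lemma PsiM : {morph Psi : x y / (x * y)%g}.
Proof. by rewrite /Psi; case: cid => ? /= []. Qed.
Lemma Psi_vertex_elt t a (v : 'rV[int]_(d t)) :
  Psi (vertex_elt a v) = (geodesic (rep t a) E * i ((rho t)%:Z *: v) * (geodesic (rep t a) E)^-1)%g.
Proof. by rewrite /Psi; case: cid => ? /= []. Qed.
Lemma Psi_iT (j : cosets) (v : 'rV[int]_(coset_rank j)) :
  Psi (@iT j v) = (geodesic (val j).2 E * i ((rho (val j).1)%:Z *: v) * (geodesic (val j).2 E)^-1)%g.
Proof. by rewrite /Psi; case: cid => ? /= []. Qed.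
Lemma Psi_edge t a : Psi (edge t a) = (geodesic (rep t a) E * i (blockv t a) * (geodesic a E)^-1)%g.
Proof. by rewrite /Psi; case: cid => ? /= []. Qed.
Lemma Psi_yT (y : loops) : exists t a, yT y = edge t a /\ ~~ is_tree t a.
Proof.
case: y => [[t a] na]; exists t, a; split=> //.
by rewrite /edge insubT.
Qed.

Definition congruent g := forall lam, (rho (tag lam) %| ab g lam)%Z.

Lemma congruentM g h : congruent g -> congruent h -> congruent (g * h)%g.
Proof. by move=> cg ch lam; rewrite abM; apply: rpredD. Qed.

Lemma congruentV g : congruent g -> congruent g^-1%g.
Proof. by move=> cg lam; rewrite abV; apply: rpredNr. Qed.

Lemma act_congruent a g : congruent g -> act a g = a.
Proof.
move=> cg; apply: resval_inj => lam; have /dvdz_mod0P z := cg lam.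
by rewrite resval_red -modzDmr z addr0 resval_mod.
Qed.

(** The loops of the successive steps telescope. *)
Lemma Psi_path_class a g : Psi (path_class a g) = (geodesic a E * g * (geodesic (act a g) E)^-1)%g.
Proof.
move: g a; apply: (fp_ind iP) => [a|t v g IH a|[]].
  by rewrite path_class1 (morph_one PsiM) act1 mulg1 mulgV.
rewrite path_classM PsiM IH actM path_class_i !mulgA; congr (_ * _ * _)%g.
rewrite /step !PsiM (morph_inv PsiM) !Psi_edge Psi_vertex_elt rep_act.
have := carry_eq a v; set b := act a (i v) => e.
have -> : i v = ((i (blockv t a))^-1 * i ((rho t)%:Z *: carry a v) * i (blockv t b))%g.
  by rewrite -mulgA -(fp_morph iP) -e (fp_morph iP) mulKg.
by rewrite !invgM !invgK !mulgA !mulgVK.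
Qed.

Lemma Psi_congruent x : congruent (Psi x).
Proof.
have vP j (v : 'rV[int]_(coset_rank j)) : congruent (Psi (@iT j v)).
  move=> lam; rewrite Psi_iT abJ ab_i /emb; case: eqP => // e.
  rewrite /vcoord; case: insub => [l|] //=; rewrite mxE e dvdz_mulr //.
have yP y : congruent (Psi (yT y)).
  have [t [a [-> _]]] := Psi_yT y; rewrite Psi_edge => lam.
  rewrite !abM abV !ab_geodesic resval_cut ab_i /emb /= /inblock.
  case: eqP => [e|_] /=; last by rewrite addr0 subrr.
  by rewrite -e vcoordE mxE add0r; case: (lam) => s l; rewrite subrr.
move: x; apply: (fp_ind TP) => [|j v x IH|y x IH].
- by move=> lam; rewrite (morph_one PsiM) ab1.
- by rewrite PsiM; apply: congruentM.
- by rewrite !PsiM (morph_inv PsiM); split; apply: congruentM => //; apply: congruentV.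
Qed.

(** The cocycle is trivial on geodesics, so only the middle of the loop given by
    a generator contributes. *)
Lemma path_class_Psi x : path_class (res0 d rho_gt0) (Psi x) = x.
Proof.
set o := res0 d rho_gt0.
have act_o a : act o (geodesic a E) = a.
  by rewrite act_geodesic //; apply: resval_inj => lam; rewrite resval_cut ltn_ord.
have th_geoV a : path_class a (geodesic a E)^-1%g = 1%g.
  by rewrite path_classV -{1}(act_o a) -actM mulgV act1 path_class_geodesic invg1.
have act_geoV a : act a (geodesic a E)^-1%g = o by rewrite -{1}(act_o a) -actM mulgV act1.
have thPM y z : path_class o (Psi (y * z)%g) = (path_class o (Psi y) * path_class o (Psi z))%g.
  by rewrite PsiM path_classM (act_congruent _ (@Psi_congruent y)).
have vP j (v : 'rV[int]_(coset_rank j)) : path_class o (Psi (@iT j v)) = @iT j v.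
  case: j v => [[t a] za] v /=; rewrite Psi_iT /= !path_classM path_class_geodesic mul1g act_o path_class_i actM act_o.
  have ac : act a (i ((rho t)%:Z *: v)) = a.
    apply: act_congruent => lam; rewrite ab_i /emb; case: eqP => // e.
    by rewrite /vcoord; case: insub => [l|] //=; rewrite mxE e dvdz_mulr.
  rewrite ac th_geoV mulg1 /step edge_tree; last by rewrite /is_tree za.
  rewrite edge_tree; last by rewrite ac /is_tree za.
  rewrite invg1 mul1g mulg1.
  have -> : carry a ((rho t)%:Z *: v) = v.
    apply/rowP => l; rewrite !mxE (zero_onP _ _ za) ?add0r; last by rewrite /inblock /= eqxx.
    by rewrite mulKz // -lt0n.
  rewrite /vertex_elt; move: (rep_zero _ t a); rewrite (rep_id rho_gt0 za) => za'.
  by rewrite (Prop_irrelevance za' za).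
have yP y : path_class o (Psi (yT y)) = yT y.
  have [t [a [-> _]]] := Psi_yT y; rewrite Psi_edge !path_classM path_class_geodesic mul1g act_o path_class_i actM act_o.
  have ac : act (rep t a) (i (blockv t a)) = a.
    apply: resval_inj => lam; rewrite resval_red resval_cut ab_i /emb /= /inblock.
    case: eqP => [e|_] /=; last by rewrite addr0 resval_mod.
    by rewrite -e vcoordE mxE add0r; case: (lam) => s l; rewrite resval_mod.
  rewrite ac th_geoV mulg1 /step ac edge_tree; last by rewrite /is_tree rep_zero.
  rewrite (_ : carry _ _ = 0) ?vertex_elt0 ?invg1 ?mul1g //.
  apply/rowP => l; rewrite !mxE (zero_onP _ _ (rep_zero rho_gt0 t a)); last by rewrite /inblock /= eqxx.
  by rewrite add0r; apply: (resval_div a (ix l)).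
move: x; apply: (fp_ind TP) => [|j v x IH|y x IH].
- by rewrite (morph_one PsiM) path_class1.
- by rewrite thPM IH vP.
- split; rewrite thPM IH ?yP //; congr (_ * _)%g.
  by rewrite (morph_inv PsiM) path_classV act_congruent ?yP //; apply/congruentV/Psi_congruent.
Qed.

Lemma Psi_inj : injective Psi.
Proof. exact: can_inj path_class_Psi. Qed.

Lemma congruent_Psi g : congruent g -> exists x, Psi x = g.
Proof.
move=> cg; exists (path_class (res0 d rho_gt0) g).
have geo0 : geodesic (res0 d rho_gt0) E = 1%g.
  rewrite /geodesic big1 // => m _; rewrite /geo_step; case: insub => // s.
  by rewrite blockv_zero ?(fp_inj0 iP) //; apply/zero_onP => lam _; apply: resval_res0.
by rewrite Psi_path_class act_congruent // geo0 invg1 mulg1 mul1g.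
Qed.
End Kurosh.

(** * The embedding for a given decomposition *)

Section Embedding.
Variables (G : groupType) (E : nat) (d : 'I_E -> nat) (r : nat -> nat).
Hypothesis d_gt0 : forall t, (0 < d t)%N.
Hypothesis r_gt0 : forall t, (0 < r (d t))%N.
Hypothesis r_dvd : forall s t, d s = 1%N -> (r (d t) %| r 1)%N.
Variable i : forall t, 'rV[int]_(d t) -> G.
Hypothesis iP : is_fp i (of_void G).
Variable al : nat -> nat -> int.
Hypothesis alP : (forall t, d t != 1%N) \/ (forall j k j' k', al j k = al j' k').
Hypothesis al_unit : forall t,
  (r (d t) %| \sum_s al (d t) (d s) - al (d t) (d t) - 1)%Z.

Let rho t := r (d t).
Implicit Types (s t : 'I_E) (lam mu : Lam d) (g h : G) (phi psi : autom G).

Definition in_lattice (h : Lam d -> int) := forall lam, (rho (tag lam) %| h lam)%Z.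

(** Noncyclic factors go to factors of the same rank, hence of the same modulus,
    and the modulus of the cyclic ones is a multiple of all the others. *)
Lemma push_lattice phi (h : Lam d -> int) : in_lattice h -> in_lattice (push iP phi h).
Proof.
move=> hL lam; apply: rpred_sum => mu _.
have [P0|P0] := eqVneq (Phi iP phi mu lam) 0; first by rewrite P0 mulr0 rpred0.
apply: dvdz_mulr; have [d1|d1] := eqVneq (d (tag mu)) 1%N.
  apply: dvdz_trans (hL mu); rewrite dvdzE !absz_nat /rho d1; exact: r_dvd d1.
by rewrite /rho (Phi_rank d_gt0 d1 P0); apply: hL.
Qed.

Let D phi := in_lattice (crossed iP al phi).
Let K := congruent iP rho.

Lemma congruent_autom phi g : K g -> K (phi g).
Proof. by move=> Kg lam; rewrite -push_ab; apply: push_lattice. Qed.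

Lemma crossed_lattice1 : D 1%g.
Proof.
have c1 lam : crossed iP al 1%g lam = 0.
  have := crossedM d_gt0 iP alP 1%g 1%g lam; rewrite mul1g => /eqP.
  rewrite eq_sym addrC -subr_eq0 addrK => /eqP.
  rewrite /push (bigD1 lam) //= /Phi [ab _ _ _]ab_bvec eqxx mulr1 big1 ?addr0 // => mu ml.
  by rewrite [ab _ _ _]ab_bvec (negPf ml) mulr0.
by move=> lam; rewrite c1 rpred0.
Qed.

Lemma crossed_latticeM phi psi : D phi -> D psi -> D (phi * psi)%g.
Proof.
by move=> Dphi Dpsi lam; rewrite (crossedM d_gt0 iP alP) rpredD //; apply: push_lattice.
Qed.

Lemma crossed_latticeV phi : D phi -> D phi^-1%g.
Proof.
move=> Dphi lam; have := crossedM d_gt0 iP alP phi^-1%g phi lam; rewrite mulVg => e.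
rewrite -[crossed _ _ _ _](addrK (push iP phi^-1%g (crossed iP al phi) lam)) -e.
by rewrite rpredB ?crossed_lattice1 //; apply: push_lattice.
Qed.

Lemma crossed_conj_lattice g lam :
  (rho (tag lam) %| crossed iP al (conj_autom g) lam - ab iP g lam)%Z.
Proof.
rewrite (crossed_conj d_gt0) -[X in _ - X]mul1r -mulrBl.
by apply: dvdz_mulr; apply: al_unit.
Qed.

(** Modulo the lattice, the crossed homomorphism sends the inner automorphism by
    [g] to the class of [g]: composing with a suitable one reaches the value
    zero. *)
Lemma crossed_lattice_ex phi : exists g, D (conj_autom g * phi)%g.
Proof.
have [g gE] := ab_surj iP (fun lam => - crossed iP al phi lam).
exists g => lam; rewrite (crossedM d_gt0 iP alP).
have -> : push iP (conj_autom g) (crossed iP al phi) lam = crossed iP al phi lam.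
  rewrite /push (bigD1 lam) //= /Phi abJ ab_bvec eqxx mulr1 big1 ?addr0 // => mu ml.
  by rewrite abJ ab_bvec (negPf ml) mulr0.
by have := crossed_conj_lattice g lam; rewrite gE opprK.
Qed.

Lemma crossed_lattice_conj g : D (conj_autom g) -> K g.
Proof.
move=> Dg lam; rewrite -[ab _ _ _](subKr (crossed iP al (conj_autom g) lam)).
by rewrite rpredB // crossed_conj_lattice.
Qed.

(** With two factors the congruence subgroup meets both of them, and an element
    centralising it lies in both. With at most one factor the moduli are [1]. *)
Lemma congruent_cent : (forall g, K g) \/
  (forall c, (forall k, K k -> c * k = k * c)%g -> c = 1%g).
Proof.
have [E1|E2] := leqP E 1.
  left=> g lam; suff -> : rho (tag lam) = 1%N by rewrite dvd1z.
  have e1 s : s = tag lam.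
    by apply: val_inj => /=; have := ltn_ord s; have := ltn_ord (tag lam); lia.
  have := al_unit (tag lam); rewrite (bigD1 (tag lam)) //= big1 => [|s]; last by rewrite (e1 s) eqxx.
  by rewrite addr0 subrr sub0r dvdzE /= dvdn1 => /eqP.
right=> c cK; pose t0 := Ordinal (ltnW E2); pose t1 := Ordinal E2.
have in_factor t : exists u : 'rV[int]_(d t), c = i u.
  pose v := (rho t)%:Z *: delta_mx ord0 (Ordinal (d_gt0 t)) : 'rV[int]_(d t).
  have v0 : v != 0.
    apply/eqP => /matrixP/(_ ord0 (Ordinal (d_gt0 t))); rewrite !mxE !eqxx mulr1 => /eqP.
    by rewrite -[0]/(Posz 0) eqz_nat => /eqP e; have := r_gt0 t; rewrite -/(rho t) e.
  have Kv : K (i v).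
    move=> lam; rewrite ab_i /emb; case: eqP => [e|_]; last exact: rpred0.
    by rewrite /vcoord; case: insub => [l|] //=; rewrite mxE e dvdz_mulr.
  have [|_ //] := malnormal iP (t := t) (h := v) (x := c) v0.
  by rewrite cK // mulgK.
have [u uE] := in_factor t0; have [u' u'E] := in_factor t1.
rewrite uE (_ : u = 0) ?(fp_inj0 iP) //; apply/rowP => l; rewrite mxE.
have := congr1 (fun g => ab iP g (ix l)) (etrans (esym uE) u'E).
by rewrite /= !ab_i embE emb_neq.
Qed.

Theorem out_congruence_embedding (T : groupType)
    (iT : forall j : cosets d rho, 'rV[int]_(coset_rank j) -> T) (yT : loops d rho -> T) :
  is_fp iT yT -> exists f : {multiplicative Out G -> Out T}, injective f.
Proof.
move=> TP; apply: (@out_embedding G T (Psi iP r_gt0 TP) K D).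
- exact: PsiM.
- exact: Psi_inj.
- exact: Psi_congruent.
- exact: congruent_Psi.
- exact: congruent_autom.
- exact: crossed_latticeM.
- exact: crossed_latticeV.
- exact: crossed_lattice_ex.
- exact: crossed_lattice_conj.
- exact: congruent_cent.
Qed.
End Embedding.

(** * Counting vertices and loops *)

Local Open Scope nat_scope.

Lemma card_pairs (I J : finType) (Q : I -> pred J) :
  #|[pred p : I * J | Q p.1 p.2]| = \sum_t #|[pred a | Q t a]|.
Proof.
rewrite -sum1_card -(pair_big_dep xpredT Q (fun _ _ => 1)) /=.
by apply: eq_bigr => t _; rewrite -sum1_card.
Qed.

Section Counting.
Variables (E : nat) (d : 'I_E -> nat) (rho : 'I_E -> nat).
Hypothesis rho_gt0 : forall t, 0 < rho t.
Local Notation A := (residues d rho).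
Implicit Types (s t : 'I_E) (lam : Lam d) (a : A).

Lemma card_zero_on (P : pred (Lam d)) :
  #|[pred a : A | zero_on P a]| = \prod_(lam | ~~ P lam) rho (tag lam).
Proof.
pose F lam : pred 'I_(rho (tag lam)) := fun x => P lam ==> (val x == 0).
have -> : #|[pred a : A | zero_on P a]| =
    #|(family F : simpl_pred {dffun forall lam : Lam d, 'I_(rho (tag lam))})|.
  by apply: eq_card => a; apply/forallP/familyP => z lam; have := z lam.
rewrite card_family foldrE big_map big_enum /= [RHS]big_mkcond /=.
apply: eq_bigr => lam _; rewrite /F; case: (P lam) => /=; last first.
  by rewrite -[RHS]card_ord; apply: eq_card.
rewrite -(card1 (Ordinal (rho_gt0 (tag lam)))); apply: eq_card => x.
by rewrite !inE -val_eqE.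
Qed.

Definition modulus := \prod_t rho t ^ d t.

Lemma prod_coords (P : pred 'I_E) :
  \prod_(lam : Lam d | P (tag lam)) rho (tag lam) = \prod_(t | P t) rho t ^ d t.
Proof.
rewrite (eq_bigl (fun lam => P (tag lam) && true)) => [|lam]; last by rewrite andbT.
rewrite -(sig_big_dep (J := fun t => 'I_(d t)) P (fun _ _ => true) (fun t _ => rho t)).
by apply: eq_bigr => t _; rewrite prod_nat_const card_ord.
Qed.

Lemma card_residues : #|A| = modulus.
Proof.
transitivity #|[pred a : A | zero_on pred0 a]|.
  by apply: eq_card => a; rewrite !inE; apply/esym/zero_onP.
by rewrite card_zero_on (prod_coords xpredT).
Qed.

Lemma rho_dvd_modulus t : rho t ^ d t %| modulus.
Proof. by rewrite /modulus (bigD1 t) //= dvdn_mulr. Qed.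

Lemma card_block_zero t : #|[pred a : A | zero_on (@inblock E d t) a]| = modulus %/ rho t ^ d t.
Proof.
rewrite card_zero_on (prod_coords (fun s => s != t)) /modulus [in RHS](bigD1 t) //=.
by rewrite mulKn // expn_gt0 rho_gt0.
Qed.

Lemma card_coset_rank k :
  #|[pred j : cosets d rho | coset_rank j == k]| = \sum_(t | d t == k) modulus %/ rho t ^ d t.
Proof.
rewrite -(fintype.card_image val_inj).
transitivity #|[pred p : 'I_E * A | (d p.1 == k) && zero_on (@inblock E d p.1) p.2]|.
  apply: eq_card => p; rewrite [RHS]inE; apply/fintype.imageP/andP => [[j jk ->]|[pk z]].
    by rewrite inE in jk; split; [exact: jk|apply: (valP j)].
  by exists (exist _ p z).
rewrite (card_pairs (fun t a => (d t == k) && zero_on (@inblock E d t) a)).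
rewrite [RHS]big_mkcond; apply: eq_bigr => t _; case: eqP => _ /=.
  by rewrite -card_block_zero.
by apply: eq_card0.
Qed.

(** Apart from the edges that end at the representative of a coset, the tree has
    one edge for each nonzero residue family: the one that introduces its last
    nonzero block. *)
Lemma card_tree :
  #|[pred p : 'I_E * A | is_tree p.1 p.2]| + 1 =
  \sum_t modulus %/ rho t ^ d t + modulus.
Proof.
pose Z (p : 'I_E * A) := zero_on (@inblock E d p.1) p.2.
pose L (p : 'I_E * A) := zero_on (@later E d p.1) p.2.
have ZE : #|[pred p | Z p]| = \sum_t modulus %/ rho t ^ d t.
  rewrite (card_pairs (fun t a => zero_on (@inblock E d t) a)).
  by apply: eq_bigr => t _; rewrite card_block_zero.
have QE : #|[pred p | ~~ Z p & L p]|.+1 = modulus.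
  rewrite -card_residues (cardD1 (res0 d rho_gt0)) inE add1n; congr _.+1.
  rewrite -[LHS](card_in_image (f := snd)).
    apply: eq_card => a; rewrite !inE andbT; apply/fintype.imageP/idP => [[p]|a0].
      rewrite inE => /andP[nz _] ->; apply: contra nz => /eqP e.
      by rewrite /Z e; apply/zero_onP => lam _; apply: resval_res0.
    have [lam nz] : exists lam, resval a lam != 0%R.
      apply/existsP; apply: contraR a0 => /existsPn z; apply/eqP/resval_inj => lam.
      by rewrite resval_res0; apply/eqP; have := z lam; rewrite negbK.
    have nz0 : ~~ zero_on (@inblock E d (tag lam)) a.
      by apply: contra nz => /zero_onP -> //; apply: eqxx.
    pose t := [arg max_(s > tag lam | ~~ zero_on (@inblock E d s) a) (s : nat)].
    exists (t, a) => //; rewrite inE /Z /L /t /=; case: arg_maxnP => // s -> smax /=.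
    apply/zero_onP => mu lt; apply/eqP; apply: contraLR lt => nzmu.
    rewrite /later -leqNgt; apply: smax; apply: contra nzmu => /zero_onP -> //; apply: eqxx.
  move=> [s a] [t b]; rewrite !inE /Z /L /= => /andP[nzs ls] /andP[nzt lt] ab.
  rewrite -{b}ab in nzt lt *; congr (_, _).
  have half x y : ~~ zero_on (@inblock E d y) a -> zero_on (@later E d x) a -> y <= x.
    move=> nz /zero_onP z; rewrite leqNgt; apply: contra nz => xy.
    by apply/zero_onP => lam /eqP e; apply: z; rewrite /later e.
  by apply/val_inj/eqP; rewrite eqn_leq !half.
rewrite -ZE -QE addn1 addnS; congr _.+1.
rewrite -(cardID [pred p | Z p]); congr (_ + _); apply: eq_card => p; rewrite !inE.
  by rewrite /is_tree -/(Z p); case: (Z p); rewrite ?andbF.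
by rewrite /is_tree -/(Z p); case: (Z p).
Qed.

Lemma card_loops :
  #|{: loops d rho}| + \sum_t modulus %/ rho t ^ d t + modulus = E * modulus + 1.
Proof.
rewrite card_sig -addnA -card_tree addnA; congr (_ + 1).
rewrite -card_residues -[X in X * _]card_ord -card_prod addnC.
by rewrite -(cardC [pred p : 'I_E * A | is_tree p.1 p.2]).
Qed.
End Counting.

(** * Indexing by rank *)

Lemma rank_bijection (J : finType) (k : J -> nat) (c : nat -> nat) :
  (forall j, 0 < k j) -> (forall n, 0 < n -> #|[pred j | k j == n]| = c n) ->
  exists2 b : J -> {i : pos_index & 'I_(c (val i))},
    bijective b & forall j, val (tag (b j)) = k j.
Proof.
move=> k0 kc; pose K (i : pos_index) := {j : J | k j == val i}.
have cardK (i : pos_index) : #|{: K i}| = c (val i).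
  by rewrite card_sig; apply: kc; apply: (valP i).
pose f (i : pos_index) (x : K i) : 'I_(c (val i)) := cast_ord (cardK i) (enum_rank x).
pose g (i : pos_index) (l : 'I_(c (val i))) : K i := enum_val (cast_ord (esym (cardK i)) l).
have fK i : cancel (f i) (g i) by move=> x; rewrite /f /g cast_ordK enum_rankK.
have gK i : cancel (g i) (f i) by move=> x; rewrite /f /g enum_valK cast_ordKV.
pose T := {i : pos_index & 'I_(c (val i))}.
pose p j : pos_index := exist (fun n => 0 < n) (k j) (k0 j).
pose b j : T := existT _ (p j) (f (p j) (exist _ j (eqxx (k j)))).
pose b' (x : T) : J := val (g (tag x) (tagged x)).
exists b => //; exists b' => [j|[i l]]; first by rewrite /b' /b /= fK.
have bE (x : K i) : b (val x) = existT _ i (f i x).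
  case: x => j /= e; case: i l e => n n0 l e; have ek := eqP e.
  rewrite /= in ek; case: n / ek n0 l e => n0 l e; rewrite /b /p.
  by rewrite (Prop_irrelevance (k0 j) n0) (Prop_irrelevance (eqxx _) e).
by rewrite /b' bE gK.
Qed.

(** * Numerical data *)

Local Open Scope classical_set_scope.
Local Open Scope nat_scope.

Lemma fsbig_uniq (X : Type) (idx : X) (op : Monoid.com_law idx) (A : set nat)
    (s : seq nat) (f : nat -> X) :
  uniq s -> (forall j, j \in s -> A j) -> (forall j, A j -> j \notin s -> f j = idx) ->
  \big[op/idx]_(j \in A) f j = \big[op/idx]_(j <- s) f j.
Proof.
move=> us sA f0; rewrite (fsbigE s f us) //.
rewrite big_seq_cond [RHS]big_seq_cond; apply: eq_bigl => j.
by case js: (j \in s) => //=; apply/mem_set/sA.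
Qed.

Lemma bezout_seq (s : seq nat) (e : nat -> nat) : uniq s ->
  exists z : nat -> int,
    (\sum_(j <- s) z j * (e j)%:Z = (\big[gcdn/0%N]_(j <- s) e j)%:Z)%R.
Proof.
elim: s => [|k s IH] /=; first by exists (fun=> 0%R); rewrite !big_nil.
move=> /andP[ks /IH[z zE]]; have [u [v uv]] := Bezoutz (Posz (e k)) (Posz (\big[gcdn/0]_(j <- s) e j)).
exists (fun j => if j == k then u else (v * z j)%R); rewrite !big_cons eqxx.
rewrite -[RHS]/(gcdz (Posz (e k)) (Posz (\big[gcdn/0]_(j <- s) e j))) -uv -zE mulr_sumr.
congr (_ + _)%R; apply: eq_big_seq => j js; case: eqP => [jk|_]; last by rewrite mulrA.
by rewrite -jk js in ks.
Qed.

Lemma mulrn_int (x : int) n : (x *+ n = x * n%:Z)%R.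
Proof. by rewrite -mulr_natr natz. Qed.

Section Ranks.
Variables (N : nat) (r e : nat -> nat).
Hypothesis r_gt0 : forall j, 0 < j -> 0 < r j.
Hypothesis e_N : forall j, 0 < j -> 0 < e j -> j <= N.

Definition factors : finType := {k : 'I_N & 'I_(e k.+1)}.
Definition nb_factors := #|factors|.
Definition rank (t : 'I_nb_factors) : nat := (tag (enum_val t)).+1.

Lemma big_rank (X : Type) (idx : X) (op : Monoid.com_law idx) (f : nat -> X) :
  \big[op/idx]_t f (rank t) = \big[op/idx]_(j <- iota 1 N) \big[op/idx]_(l < e j) f j.
Proof.
rewrite -(big_enum_val (fun x : factors => f (tag x).+1)) /=.
rewrite (eq_bigl (fun x : factors => xpredT (tag x) && true)) //.
rewrite -(sig_big_dep (J := fun k : 'I_N => 'I_(e k.+1)) xpredT (fun _ _ => true)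
  (fun k _ => f k.+1)) /=.
rewrite -[iota 1 N]/(iota (1 + 0) N) iotaDl big_map -(big_mkord xpredT (fun k => \big[op/idx]_(l < e k.+1) f k.+1)).
by rewrite /index_iota subn0.
Qed.

Lemma big_pos (X : Type) (idx : X) (op : Monoid.com_law idx) (f : nat -> X) :
  (forall j, e j = 0 -> f j = idx) ->
  \big[op/idx]_(j \in [set j | 0 < j]) f j = \big[op/idx]_(j <- iota 1 N) f j.
Proof.
move=> f0; apply: fsbig_uniq => [||j j0]; first exact: iota_uniq.
  by move=> j; rewrite mem_iota => /andP[].
rewrite mem_iota add1n ltnS j0 /= -ltnNge => jN; apply: f0.
by apply/eqP; rewrite -leqn0 leqNgt; apply/negP => /(e_N j0); rewrite leqNgt jN.
Qed.

Lemma rank_gt0 t : 0 < rank t. Proof. by []. Qed.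

Lemma e_rank t : 0 < e (rank t).
Proof. by rewrite /rank; case: (enum_val t) => k l /=; apply: leq_ltn_trans (ltn_ord l). Qed.

Lemma nb_factorsE : nb_factors = \big[addn/0]_(j \in [set j | 0 < j]) e j.
Proof.
rewrite big_pos // -[LHS]card_ord -sum1_card.
rewrite (big_rank _ (fun=> 1)); apply: eq_bigr => j _.
by rewrite sum1_card card_ord.
Qed.

Lemma card_rank k : 0 < k -> #|[pred t | rank t == k]| = e k.
Proof.
move=> k0; rewrite -sum1_card big_mkcond /= (big_rank _ (fun j => if j == k then 1 else 0)).
have [ek|ek] := posnP (e k).
  rewrite ek big1_seq // => j _; case: eqP => [->|_]; last by rewrite big1.
  by rewrite ek big_ord0.
rewrite (bigD1_seq k) ?iota_uniq //=; last by rewrite mem_iota k0 add1n ltnS e_N.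
rewrite eqxx sum1_card card_ord big1 ?addn0 // => j /negPf ->.
by rewrite big1.
Qed.

Local Notation rho := (fun t => r (rank t)).

Lemma modulusE : modulus rank rho = \big[muln/1]_(j \in [set j | 0 < j]) r j ^ (j * e j).
Proof.
rewrite big_pos => [|j ->]; last by rewrite muln0.
rewrite /modulus (big_rank _ (fun j => r j ^ j)); apply: eq_bigr => j _.
by rewrite prod_nat_const card_ord expnM.
Qed.

Lemma coset_count k : 0 < k ->
  #|[pred j : cosets rank rho | coset_rank j == k]| =
  (e k * modulus rank rho) %/ r k ^ k.
Proof.
move=> k0; rewrite (card_coset_rank rank (fun t => r_gt0 (rank_gt0 t))).
rewrite (eq_bigr (fun=> modulus rank rho %/ r k ^ k)) => [|t /eqP -> //].
rewrite sum_nat_const card_rank //; have [->|ek] := posnP (e k); first by rewrite !mul0n div0n.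
have [t /eqP tk] : exists t, rank t == k.
  by apply/existsP; apply: contraLR ek; rewrite -card_rank // lt0n negbK.
by rewrite muln_divA // -tk (@rho_dvd_modulus _ rank rho).
Qed.

Lemma coset_total : \sum_t modulus rank rho %/ r (rank t) ^ rank t =
  \big[addn/0]_(k \in [set k | 0 < k]) ((e k * modulus rank rho) %/ r k ^ k).
Proof.
rewrite big_pos => [|j ->]; last by rewrite mul0n div0n.
rewrite (big_rank _ (fun j => modulus rank rho %/ r j ^ j)); apply: eq_big_seq => k.
rewrite mem_iota => /andP[k0 _]; rewrite sum_nat_const card_ord -coset_count //.
rewrite (card_coset_rank rank (fun t => r_gt0 (rank_gt0 t))).
rewrite [RHS](eq_bigr (fun=> modulus rank rho %/ r k ^ k)) => [|t /eqP -> //].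
by rewrite sum_nat_const card_rank.
Qed.

Local Open Scope ring_scope.

(** The numerical hypotheses are what makes the multiplier on inner
    automorphisms invertible modulo each of the moduli, after a rescaling in the
    presence of cyclic factors and after weighting the ranks in their absence. *)
Lemma weights_exist :
  (forall j, (0 < j)%N -> (0 < e j)%N -> (r j %| r 1)%N) ->
  ((0 < e 1)%N -> gcdn (nb_factors - 1) (r 1) = 1%N) ->
  (e 1%N = 0%N -> forall j, (0 < j)%N -> (0 < e j)%N ->
     gcdn (gcdn (e j - 1) (r j))
       (\big[gcdn/0%N]_(k \in [set k | (0 < k)%N /\ k <> j]) e k) = 1%N) ->
  exists al : nat -> nat -> int,
    ((forall t, rank t != 1%N) \/ (forall j k j' k', al j k = al j' k')) /\
    forall t, (r (rank t) %| \sum_s al (rank t) (rank s) - al (rank t) (rank t) - 1)%Z.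
Proof.
move=> r1 cyc noncyc; have [e1|e1] := posnP (e 1%N); last first.
  have [u [v uv]] := Bezoutz (nb_factors - 1)%N%:Z (r 1%N)%:Z.
  have {}uv : u * (nb_factors - 1)%N%:Z + v * (r 1%N)%:Z = 1 by rewrite uv /gcdz /= cyc.
  exists (fun _ _ => u); split=> [|t]; first by right.
  have n1 : (0 < nb_factors)%N := leq_ltn_trans (leq0n t) (ltn_ord t).
  rewrite sumr_const card_ord mulrn_int.
  have -> : u * nb_factors%:Z - u - 1 = - v * (r 1%N)%:Z.
    by rewrite -uv -subzn //; ring.
  by apply: dvdz_mull; rewrite dvdzE !absz_nat r1 ?e_rank.
have H j : exists a : nat -> int, (0 < j)%N -> (0 < e j)%N ->
    (r j %| \sum_(k <- iota 1 N) a k *+ e k - a j - 1)%Z.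
  have [ej|ej] := posnP (e j); first by exists (fun=> 0).
  have [->|j0] := posnP j; first by exists (fun=> 0).
  pose s := [seq k <- iota 1 N | k != j].
  have us : uniq s by rewrite filter_uniq ?iota_uniq.
  have [z zE] := bezout_seq e us.
  have [u [v uv]] := Bezoutz (e j - 1)%N%:Z (r j)%:Z.
  pose g : int := gcdz (e j - 1)%N%:Z (r j)%:Z; pose B := (\big[gcdn/0%N]_(k <- s) e k).
  have [u' [v' uv']] := Bezoutz g B%:Z.
  have gB : gcdz g B%:Z = 1.
    have := noncyc e1 j j0 ej; rewrite (fsbig_uniq _ us) => [nc|k|k [k0 kj]].
    - by rewrite -[RHS]/(1%N%:Z) -nc.
    - by rewrite mem_filter mem_iota => /andP[/eqP kj /andP[]].
    rewrite mem_filter (introN eqP kj) mem_iota k0 /= add1n ltnS -ltnNge => kN.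
    by apply/eqP; rewrite -leqn0 leqNgt; apply/negP => /(e_N k0); rewrite leqNgt kN.
  exists (fun k => if k == j then u' * u else v' * z k) => _ _; rewrite eqxx.
  rewrite (bigD1_seq j) ?iota_uniq ?mem_iota ?j0 ?add1n ?ltnS ?e_N //= eqxx.
  have -> : \sum_(k <- iota 1 N | k != j) (if k == j then u' * u else v' * z k) *+ e k = v' * B%:Z.
    rewrite -zE big_filter mulr_sumr; apply: eq_bigr => k /negPf ->.
    by rewrite mulrn_int mulrA.
  have -> : u' * u *+ e j + v' * B%:Z - u' * u - 1 = - (u' * v) * (r j)%:Z.
    rewrite -gB -uv' -[g]uv -subzn // mulrn_int; ring.
  exact: dvdz_mull.
have [al alP] := choice H; exists al; split=> [|t].
  by left=> t; apply/eqP => t1; have := e_rank t; rewrite t1 e1.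
rewrite (big_rank _ (al (rank t))) (eq_bigr (fun k => al (rank t) k *+ e k)).
  by apply: alP => //; apply: e_rank.
by move=> k _; rewrite sumr_const card_ord.
Qed.
End Ranks.

Theorem corollary4p6 (r e : nat -> nat)
  (r_gt0 : forall i, 0 < i -> 0 < r i)
  (E_finite : finite_set [set i | 0 < i /\ e i <> 0]) :
  let E := \big[addn/0]_(i \in [set i | 0 < i]) e i in
  let R := \big[muln/1]_(i \in [set i | 0 < i]) r i ^ (i * e i) in
  let c := fun i => (e i * R) %/ r i ^ i in
  let S := \big[addn/0]_(i \in [set i | 0 < i]) c i in
  (forall i, 0 < i -> 0 < e i -> r i %| r 1) ->
  (0 < e 1 -> gcdn (E - 1) (r 1) = 1) ->
  (e 1 = 0 -> forall i, 0 < i -> 0 < e i ->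
     gcdn (gcdn (e i - 1) (r i))
       (\big[gcdn/0]_(j \in [set j | 0 < j /\ j <> i]) e j) = 1) ->
  exists n : nat,
    (n%:Z = (E%:Z - 1) * R%:Z - S%:Z + 1)%R /\
    exists f : {multiplicative
        Out (Zfree_product e) -> Out (free_product2 (F_ n) (Zfree_product c))},
      injective f.
Proof.
move=> E R c S r1 cyc noncyc.
have [s sE] : exists s : seq nat, [set i | 0 < i /\ e i <> 0] = [set` s].
  by have /finite_seqP := E_finite.
pose N := \max_(i <- s) i.
have e_N j : 0 < j -> 0 < e j -> j <= N.
  move=> j0 ej; have : [set` s] j by rewrite -sE; split=> // e0; rewrite e0 in ej.
  by move=> js; apply: leq_bigmax_seq.
pose d := @rank N e; pose rho t := r (d t).
have d_gt0 t : 0 < d t by [].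
have rho_gt0 t : 0 < rho t by apply: r_gt0.
have EE : nb_factors N e = E := nb_factorsE e_N.
have RE : modulus d rho = R := modulusE r e_N.
have SE : \sum_t modulus d rho %/ rho t ^ d t = S.
  by rewrite /S /c -RE; apply: coset_total.
have [b b_bij bE] := rank_bijection d_gt0 (card_rank e_N).
have [||b' b'_bij b'E] := @rank_bijection (cosets d rho) (@coset_rank _ d rho) c.
- by move=> j; apply: d_gt0.
- by move=> k k0; rewrite coset_count // /c -RE.
exists #|{: loops d rho}|; split.
  have := card_loops d rho_gt0; rewrite SE RE; set n := #|_| => e'.
  have {}e' : (n%:Z + S%:Z + R%:Z = E%:Z * R%:Z + 1)%R by rewrite -!PoszD e' EE PoszD PoszM.
  by rewrite mulrBl mul1r -[LHS](addrK (S%:Z + R%:Z)%R) addrA e'; ring.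
have id_bij : bijective (@id void) by exists id.
have [i iP] := is_fp_reindex (Zfree_product_fp e) b_bij id_bij bE.
have iP' : is_fp i (of_void (Zfree_product e)).
  by move: iP; congr (is_fp _ _); apply/funext => -[].
have g_bij : bijective (enum_rank : loops d rho -> 'I_#|{: loops d rho}|) := @enum_rank_bij _.
have [iT TP] := is_fp_reindex (free_Zfree_product_fp _ c) b'_bij g_bij b'E.
have [|al [alP al_unit]] := weights_exist e_N r1 _ noncyc; first by rewrite EE.
have r_dvd s' t : d s' = 1 -> r (d t) %| r 1 by move=> _; apply: r1; rewrite ?e_rank.
exact: (out_congruence_embedding d_gt0 rho_gt0 r_dvd iP' alP al_unit TP).
Qed.
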